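(* Consider the two-cell MIMO reverse-TDD cellular network described in the context, with channel entries drawn i.i.d. from a continuous distribution. Let $d_\alpha,d_\beta$ be positive integers and consider the symmetric tuple $d_{\alpha k}=d_\alpha$ for all $k\in[1:K]$, $d_{\beta l}=d_\beta$ for all $l\in[1:L]$. If \begin{align*} &Kd_\alpha\le M_\alpha,\qquad Ld_\beta\le M_\beta,\qquad Kd_\alpha+Ld_\beta\le\max(M_\alpha,M_\beta),\\ &\mathrm{mod}(N_{\alpha k}-d_\alpha,d_\beta)=\mathrm{mod}(N_{\beta l}-d_\beta,d_\alpha)=0\quad\text{for all }k\in[1:K],\ l\in[1:L],\\ &|\mathcal I_\alpha|\,|\mathcal I_\beta|\,d_\alpha d_\beta\le\sum_{k\in\mathcal I_\alpha}d_\alpha(N_{\alpha k}-d_\alpha)+\sum_{l\in\mathcal I_\beta}d_\beta(N_{\beta l}-d_\beta)\quad\text{for all }\mathcal I_\alpha\subseteq[1:K],\ \mathcal I_\beta\subseteq[1:L], \end{align*} then this symmetric tuple is feasible almost surely.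
   Context: Network model: Cell $\alpha$ operates in downlink: BS $\alpha$ with $M_\alpha$ antennas transmits to users $(\alpha,k)$, $k\in[1:K]$, user $(\alpha,k)$ having $N_{\alpha k}$ antennas. Cell $\beta$ operates in uplink: users $(\beta,l)$, $l\in[1:L]$, with $N_{\beta l}$ antennas transmit to BS $\beta$ with $M_\beta$ antennas. Received signals: $\mathbf y_{\alpha k}=\mathbf H_{\alpha k}\mathbf x_\alpha+\sum_{l=1}^L\mathbf G_{\alpha kl}\mathbf x_{\beta l}+\mathbf z_{\alpha k}$ and $\mathbf y_\beta=\sum_{l=1}^L\mathbf H_{\beta l}\mathbf x_{\beta l}+\mathbf G_\beta\mathbf x_\alpha+\mathbf z_\beta$, where $\mathbf H_{\alpha k}\in\mathbb C^{N_{\alpha k}\times M_\alpha}$, $\mathbf G_{\alpha kl}\in\mathbb C^{N_{\alpha k}\times N_{\beta l}}$, $\mathbf H_{\beta l}\in\mathbb C^{M_\beta\times N_{\beta l}}$, $\mathbf G_\beta\in\mathbb C^{M_\beta\times M_\alpha}$, all entries i.i.d. from a continuous distribution. Feasibility: a tuple $(d_{\alpha 1},\dots,d_{\alpha K},d_{\beta 1},\dots,d_{\beta L})$ of positive integers is feasible if there exist $\mathbf V_{\alpha k}\in\mathbb C^{M_\alpha\times d_{\alpha k}}$, $\mathbf U_{\alpha k}\in\mathbb C^{N_{\alpha k}\times d_{\alpha k}}$, $\mathbf V_{\beta l}\in\mathbb C^{N_{\beta l}\times d_{\beta l}}$, $\mathbf U_{\beta l}\in\mathbb C^{M_\beta\times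 d_{\beta l}}$ with $\mathbf U_{\alpha k}^\dagger\mathbf G_{\alpha kl}\mathbf V_{\beta l}=\mathbf 0$ ($\forall k,l$), $\mathbf U_{\beta l}^\dagger\mathbf G_\beta\mathbf V_{\alpha k}=\mathbf 0$ ($\forall k,l$), $\mathbf U_{\alpha k}^\dagger\mathbf H_{\alpha k}\mathbf V_{\alpha i}=\mathbf 0$ ($\forall i\ne k$), $\mathbf U_{\beta l}^\dagger\mathbf H_{\beta j}\mathbf V_{\beta j}=\mathbf 0$ ($\forall j\ne l$), $\mathrm{rank}(\mathbf U_{\alpha k}^\dagger\mathbf H_{\alpha k}\mathbf V_{\alpha k})=d_{\alpha k}$, $\mathrm{rank}(\mathbf U_{\beta l}^\dagger\mathbf H_{\beta l}\mathbf V_{\beta l})=d_{\beta l}$ ($\dagger$ = conjugate transpose). $\mathrm{mod}(n,m)$ denotes the remainder of $n$ divided by $m$. *)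

(* Defs.v *)
From HB Require Import structures.
From mathcomp Require Import all_boot all_order all_algebra.
From mathcomp Require Import complex.
From mathcomp Require Import all_classical all_reals all_analysis.
Set Implicit Arguments. Unset Strict Implicit. Unset Printing Implicit Defensive.
Import Order.TTheory GRing.Theory Num.Theory.
Local Open Scope ring_scope.
Local Open Scope classical_set_scope.

Definition ctrans (R : rcfType) (m n : nat) (A : 'M[R[i]]_(m, n)) : 'M[R[i]]_(n, m) :=
  map_mx (@Num.conj_op _) A^T.

Definition feasible (R : rcfType) (K L Ma Mb : nat)
  (Na : 'I_K -> nat) (Nb : 'I_L -> nat)
  (Ha : forall k, 'M[R[i]]_(Na k, Ma))
  (Ga : forall k l, 'M[R[i]]_(Na k, Nb l))
  (Hb : forall l, 'M[R[i]]_(Mb, Nb l))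
  (Gb : 'M[R[i]]_(Mb, Ma))
  (da : 'I_K -> nat) (db : 'I_L -> nat) : Prop :=
  exists (Va : forall k, 'M[R[i]]_(Ma, da k)) (Ua : forall k, 'M[R[i]]_(Na k, da k))
         (Vb : forall l, 'M[R[i]]_(Nb l, db l)) (Ub : forall l, 'M[R[i]]_(Mb, db l)),
    [/\ (forall k l, ctrans (Ua k) *m Ga k l *m Vb l = 0),
        (forall k l, ctrans (Ub l) *m Gb *m Va k = 0),
        (forall k i, i != k -> ctrans (Ua k) *m Ha k *m Va i = 0) &
        (forall l j, j != l -> ctrans (Ub l) *m Hb j *m Vb j = 0)] /\
    (forall k, \rank (ctrans (Ua k) *m Ha k *m Va k) = da k) /\
    (forall l, \rank (ctrans (Ub l) *m Hb l *m Vb l) = db l).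

Definition reim (R : rcfType) (z : R[i]) : R * R :=
  let: Complex a b := z in (a, b).

Definition channel_entries (R : rcfType) (T : Type) (K L Ma Mb : nat)
  (Na : 'I_K -> nat) (Nb : 'I_L -> nat)
  (Ha : forall k, T -> 'M[R[i]]_(Na k, Ma))
  (Ga : forall k l, T -> 'M[R[i]]_(Na k, Nb l))
  (Hb : forall l, T -> 'M[R[i]]_(Mb, Nb l))
  (Gb : T -> 'M[R[i]]_(Mb, Ma)) : seq (T -> R[i]) :=
  flatten [seq flatten [seq [seq (fun w => Ha k w i j) | j <- enum 'I_Ma]
                        | i <- enum 'I_(Na k)] | k <- enum 'I_K]
  ++ flatten [seq flatten [seq flatten [seq [seq (fun w => Ga k l w i j) | j <- enum 'I_(Nb l)]
                        | i <- enum 'I_(Na k)] | l <- enum 'I_L] | k <- enum 'I_K]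
  ++ flatten [seq flatten [seq [seq (fun w => Hb l w i j) | j <- enum 'I_(Nb l)]
                        | i <- enum 'I_Mb] | l <- enum 'I_L]
  ++ flatten [seq [seq (fun w => Gb w i j) | j <- enum 'I_Ma] | i <- enum 'I_Mb].

Definition iid_continuous (R : realType) (d : measure_display) (T : measurableType d)
  (P : probability T R) (Xs : seq (T -> R[i])) : Prop :=
  let n := size Xs in
  let X (j : 'I_n) : T -> R * R := fun w => reim (nth (fun=> 0) Xs j w) in
  [/\ (forall j, measurable_fun setT (X j)),
      (forall A : 'I_n -> set (R * R), (forall j, measurable (A j)) ->
         fine (P [set w | forall j, A j (X j w)]) =
         \prod_(j < n) fine (P (X j @^-1` A j))),
      (forall (j j' : 'I_n) (A : set (R * R)), measurable A ->
         P (X j @^-1` A) = P (X j' @^-1` A)) &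
      (forall (j : 'I_n) (A : set (R * R)), measurable A ->
         ((@lebesgue_measure R) \x (@lebesgue_measure R))%E A = 0%E ->
         P (X j @^-1` A) = 0%E)].

(* Main.v *)
(* With W_k = U_{alpha k}^dagger all conditions are polynomial in the channel and
   in the filters.  By quantifier elimination over the algebraically closed field
   R[i], solvability of such a system is constant off the zero set of one nonzero
   polynomial D of the channel.  As D almost surely does not vanish at the channel,
   it suffices to exhibit, for each nonzero D, a solvable channel where D <> 0.

   Write N_{alpha k} = d_alpha + d_beta a_k and N_{beta l} = d_beta + d_alpha b_l.
   The inequalities on subsets then say exactly that each edge (k, l) can be owned
   by one of its two ends so that k owns at most a_k edges and l at most b_l.
   This yields interference channels G0, with solutions W0 and V0, at which the
   linearisation of (W, V) |-> (W_k G_kl V_l) is onto.  So for each direction C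
   the curve G0 + s C can be corrected by a term O(s^2) into a curve of solvable
   channels, and for some C the polynomial D does not vanish identically on it.
   The remaining channels and filters then come from full rank conditions. *)
Require Import Defs.
From HB Require Import structures.
From mathcomp Require Import all_boot all_order all_algebra all_field.
From mathcomp Require Import complex zify ring boolp.
Set Implicit Arguments. Unset Strict Implicit. Unset Printing Implicit Defensive.
Import Order.TTheory GRing.Theory Num.Theory.

(** * Charging the edges of a bipartite graph to ends of bounded capacity *)

Lemma card_setX_supermodular (S T : finType) (E : {set S * T}) (e : S * T)
    (A A' : {set S}) (B B' : {set T}) :
  e \in E -> e.1 \in A -> e.2 \notin B -> e.1 \notin A' -> e.2 \in B' ->
  (#|E :&: setX A B| + #|E :&: setX A' B'| <
   #|E :&: setX (A :|: A') (B :|: B')| + #|E :&: setX (A :&: A') (B :&: B')|)%N.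
Proof.
move=> Ee eA eB eA' eB'.
rewrite -cardsUI; set X := E :&: setX A B; set Y := E :&: setX A' B'.
have -> : E :&: setX (A :&: A') (B :&: B') = X :&: Y.
  by apply/setP=> x; rewrite !inE; do !case: (_ \in _).
rewrite ltn_add2r; apply/proper_card/properP; split.
  apply/subsetP=> x; rewrite !inE.
  by do !case: (_ \in _).
(* Strictness: [e] joins [A] to [B'], so it lies in the rectangle of the unions but in neither of
   the two given rectangles. *)
exists e; rewrite !inE Ee eA ?eB' ?orbT //=.
by rewrite (negPf eB) (negPf eA') ?andbF.
Qed.

(* An edge can be charged to one of its two ends unless each end lies in a
   tight set avoiding the other one; by supermodularity of the number of edges
   these two tight sets cannot coexist. *)
Lemma edge_orientation (S T : finType) (E : {set S * T}) (a : S -> nat) (b : T -> nat) :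
  (forall (A : {set S}) (B : {set T}),
     #|E :&: setX A B| <= \sum_(x in A) a x + \sum_(y in B) b y)%N ->
  exists O : {set S * T},
    (forall x, #|[set y | (x, y) \in E :&: O]| <= a x)%N /\
    (forall y, #|[set x | (x, y) \in E :\: O]| <= b y)%N.
Proof.
move: {2}#|E| (leqnn #|E|) => n; elim: n E a b => [|n IHn] E a b.
  rewrite leqn0 cards_eq0 => /eqP-> _; exists set0; split=> z;
    by rewrite (eq_card (B := pred0)) ?card0 // => t; rewrite !inE.
move=> leE Eab; have [->|[e Ee]] := set_0Vmem E.
  by exists set0; split=> z;
    rewrite (eq_card (B := pred0)) ?card0 // => t; rewrite !inE.
pose E' := E :\ e.
have eqe x y : ((x, y) == e) = (x == e.1) && (y == e.2) by case: (e).
have leE' : (#|E'| <= n)%N by move: leE; rewrite (cardsD1 e E) Ee.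
have cE' (A : {set S}) (B : {set T}) :
    #|E :&: setX A B| = ((e.1 \in A) && (e.2 \in B) + #|E' :&: setX A B|)%N.
  rewrite (cardsD1 e) !inE Ee /=; congr (_ + _)%N; apply: eq_card => x.
  by rewrite !inE; do !case: (_ \in _); rewrite ?andbF ?andbT.
(* The capacities left once [e] is charged to its first, respectively its second, end. *)
pose a' x := (a x - (x == e.1))%N; pose b' y := (b y - (y == e.2))%N.
have sumdec (I : finType) (i0 : I) (f : I -> nat) (A : {set I}) : i0 \in A -> (0 < f i0)%N ->
    (\sum_(i in A) f i = (\sum_(i in A) (f i - (i == i0))).+1)%N.
  move=> Ai0 f0; rewrite (bigD1 i0) //= [in RHS](bigD1 i0) //= eqxx.
  rewrite (eq_bigr (fun i => f i - (i == i0)))%N; first by lia.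
  by move=> i /andP[_ /negPf->]; rewrite subn0.
have sumdec0 (I : finType) (i0 : I) (f : I -> nat) (A : {set I}) : i0 \notin A ->
    (\sum_(i in A) f i = (\sum_(i in A) (f i - (i == i0))))%N.
  move=> Ai0; apply: eq_bigr => i Ai; case: eqP => [eii|]; last by rewrite subn0.
  by rewrite -eii Ai in Ai0.
have [|Na] := boolP ((0 < a e.1) && [forall A : {set S}, forall B : {set T},
   #|E' :&: setX A B| <= \sum_(x in A) a' x + \sum_(y in B) b y])%N.
  case/andP=> a0 /forallP Ha.
  have [O [Oa Ob]] := IHn E' a' b leE' (fun A B => forallP (Ha A) B).
  exists (e |: O); split=> [x|y].
    have [xe|nxe] := eqVneq x e.1.
      rewrite (cardsD1 e.2) !inE xe -surjective_pairing Ee eqxx /=.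
      have := Oa x; rewrite /a' xe eqxx => H.
      have : (#|[set y | (e.1, y) \in E' :&: O]| <= (a e.1).-1)%N by lia.
      suff -> : [set y | (e.1, y) \in E :&: (e |: O)] :\ e.2 = [set y | (e.1, y) \in E' :&: O] by lia.
      apply/setP=> y; rewrite !inE eqe eqxx /=.
      by case: eqP => //=; rewrite andbC.
    have := Oa x; rewrite /a' (negPf nxe) subn0; congr (_ <= _)%N; apply: eq_card=> y.
    by rewrite !inE eqe (negPf nxe).
  rewrite (leq_trans _ (Ob y)) //; apply/subset_leq_card/subsetP=> x; rewrite !inE.
  by rewrite negb_or -andbA => /and3P[-> -> ->].
have [|Nb] := boolP ((0 < b e.2) && [forall A : {set S}, forall B : {set T},
   #|E' :&: setX A B| <= \sum_(x in A) a x + \sum_(y in B) b' y])%N.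
  case/andP=> b0 /forallP Hb.
  have [O [Oa Ob]] := IHn E' a b' leE' (fun A B => forallP (Hb A) B).
  exists (O :\ e); split=> [x|y].
    rewrite (leq_trans _ (Oa x)) //; apply/subset_leq_card/subsetP=> y; rewrite !inE.
    by case/and3P=> -> -> ->.
  have [ye|nye] := eqVneq y e.2.
    rewrite (cardsD1 e.1) !inE ye -surjective_pairing Ee eqxx /=.
    have := Ob y; rewrite /b' ye eqxx => H.
    have : (#|[set x | (x, e.2) \in E' :\: O]| <= (b e.2).-1)%N by lia.
    suff -> : [set x | (x, e.2) \in E :\: (O :\ e)] :\ e.1 = [set x | (x, e.2) \in E' :\: O] by lia.
    apply/setP=> x; rewrite !inE eqe eqxx andbT.
    by case: eqP => //=; rewrite ?andbF.
  have := Ob y; rewrite /b' (negPf nye) subn0; congr (_ <= _)%N; apply: eq_card=> x.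
  by rewrite !inE eqe (negPf nye) andbF.
(* If [e.1] has no capacity, the singleton of [e.1] with the empty set is tight. Otherwise some
   rectangle violates the bound for [E'] and [a'] but not the one for [E] and [a]. So [A] contains
   [e.1], and [B] misses [e.2], since otherwise the removal of [e] would offset the lost unit of
   capacity. *)
have tightA : exists (A : {set S}) (B : {set T}), [/\ e.1 \in A, e.2 \notin B &
    #|E :&: setX A B| = \sum_(x in A) a x + \sum_(y in B) b y]%N.
  have [a0|a0] := posnP (a e.1).
    exists [set e.1], set0; rewrite !inE; split=> //; rewrite big_set1 big_set0 a0.
    by apply/eqP; rewrite cards_eq0; apply/eqP/setP=> x; rewrite !inE !andbF.
  move: Na; rewrite a0 /=.
  case/forallPn=> A /forallPn[B]; rewrite -ltnNge => lAB; exists A, B.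
  have := Eab A B; rewrite cE'; move: lAB.
  have [eA|eA] := boolP (e.1 \in A); last by rewrite /a' -sumdec0 //=; lia.
  rewrite /a' (sumdec _ e.1 a A) //=.
  by have [eB|eB] /= := boolP (e.2 \in B); [lia|move=> *; split=> //; lia].
have tightB : exists (A : {set S}) (B : {set T}), [/\ e.1 \notin A, e.2 \in B &
    #|E :&: setX A B| = \sum_(x in A) a x + \sum_(y in B) b y]%N.
  have [b0|b0] := posnP (b e.2).
    exists set0, [set e.2]; rewrite !inE; split=> //; rewrite big_set1 big_set0 b0.
    by apply/eqP; rewrite cards_eq0; apply/eqP/setP=> x; rewrite !inE !andbF.
  move: Nb; rewrite b0 /=.
  case/forallPn=> A /forallPn[B]; rewrite -ltnNge => lAB; exists A, B.
  have := Eab A B; rewrite cE'; move: lAB.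
  have [eB|eB] := boolP (e.2 \in B); last by rewrite /b' -sumdec0 //=; lia.
  rewrite /b' (sumdec _ e.2 b B) // andbT /=.
  by have [eA|eA] /= := boolP (e.1 \in A); [lia|move=> *; split=> //; lia].
have [A [B [eA eB tAB]]] := tightA; have [A' [B' [eA' eB' tAB']]] := tightB.
have := card_setX_supermodular Ee eA eB eA' eB'.
(* Capacities are modular, so strict supermodularity at two tight rectangles breaks [Eab] at the
   union or at the intersection. *)
have sumUI (I : finType) (f : I -> nat) (X Y : {set I}) :
    (\sum_(i in X) f i + \sum_(i in Y) f i = \sum_(i in X :|: Y) f i + \sum_(i in X :&: Y) f i)%N.
  rewrite [\sum_(i in X :|: Y) _](big_setID X) [\sum_(i in Y) _](big_setID X) /=.
  by rewrite setUK setDUl setDv set0U (setIC Y); lia.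
have := Eab (A :|: A') (B :|: B'); have := Eab (A :&: A') (B :&: B').
by have := sumUI _ a A A'; have := sumUI _ b B B'; lia.
Qed.

Local Open Scope ring_scope.

(** * Polynomial expressions and their zeros along lines and curves *)

Inductive pexpr (F J : Type) :=
  | PConst of F
  | PVar of J
  | PAdd of pexpr F J & pexpr F J
  | PMul of pexpr F J & pexpr F J.
Arguments PConst {F J}. Arguments PVar {F J}.

(** The target ring varies: [F] itself, [{poly F}] for restriction to a line, and [{poly {poly F}}]
    for deformations with two parameters; [h] embeds the constants. *)
Fixpoint peval (F J : Type) (R : comNzRingType) (h : F -> R) (v : J -> R)
    (D : pexpr F J) : R :=
  match D with
  | PConst a => h a
  | PVar x => v x
  | PAdd D1 D2 => peval h v D1 + peval h v D2
  | PMul D1 D2 => peval h v D1 * peval h v D2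
  end.

Lemma peval_rmorph (F J : Type) (R S : comNzRingType) (f : {rmorphism R -> S})
    (h : F -> R) (v : J -> R) (D : pexpr F J) :
  f (peval h v D) = peval (f \o h) (f \o v) D.
Proof. by elim: D => //= D1 <- D2 <-; rewrite ?rmorphD ?rmorphM. Qed.

Lemma eq_peval (F J : Type) (R : comNzRingType) (h h' : F -> R) (v v' : J -> R)
    (D : pexpr F J) :
  h =1 h' -> v =1 v' -> peval h v D = peval h' v' D.
Proof. by move=> hh vv; elim: D => //= D1 -> D2 ->. Qed.

Section ClosedField.
Variable F : closedFieldType.

Lemma nonroot_ex (p : {poly F}) : p != 0 -> exists s, p.[s] != 0.
Proof. by move/closed_nonrootP=> [s ps]; exists s. Qed.

Lemma poly_fun_eq0 (p : {poly F}) : (forall s, p.[s] = 0) -> p = 0.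
Proof.
by move=> p0; apply/eqP; apply: contraT => /nonroot_ex[s]; rewrite p0 eqxx.
Qed.

Definition pline (J : Type) (D : pexpr F J) (c u : J -> F) : {poly F} :=
  peval polyC (fun x => (c x)%:P + 'X * (u x)%:P) D.

Lemma horner_pline (J : Type) (D : pexpr F J) c u s :
  (pline D c u).[s] = peval id (fun x => c x + s * u x) D.
Proof.
rewrite -horner_evalE [LHS]peval_rmorph; apply: eq_peval => x /=.
  by rewrite /horner_eval hornerC.
by rewrite /horner_eval !hornerE.
Qed.

(** Restricted to the line, [D] is a nonzero polynomial because its value at 0 is that of [D] at
    [c]; its product with [q] then has a nonroot. The factor [q] carries a second open condition to
    be met at the same point. *)
Lemma line_nonroot (J : Type) (D : pexpr F J) (c c' : J -> F) (q : {poly F}) :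
  peval id c D != 0 -> q != 0 ->
  exists s, peval id (fun x => c x + s * (c' x - c x)) D != 0 /\ q.[s] != 0.
Proof.
move=> Dc q0; pose p := pline D c (fun x => c' x - c x).
have p0 : p != 0.
  apply: contraNneq Dc => p0; have := horner_pline D c (fun x => c' x - c x) 0.
  rewrite -/p p0 horner0 => ->; apply/eqP; apply: eq_peval => // x.
  by rewrite mul0r addr0.
have /nonroot_ex[s] : p * q != 0 by rewrite mulf_neq0.
by rewrite hornerM mulf_eq0 negb_or horner_pline => /andP[? ?]; exists s.
Qed.

(** Irreducibility of affine space, reduced to one variable on the line that joins the two
    nonroots. *)
Lemma mul_nonzero (J : Type) (D D' : pexpr F J) :
  (exists c, peval id c D != 0) -> (exists c, peval id c D' != 0) ->
  exists c, peval id c (PMul D D') != 0.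
Proof.
move=> [c Dc] [c' Dc'].
have q0 : pline D' c (fun x => c' x - c x) != 0.
  apply: contraNneq Dc' => q0; have := horner_pline D' c (fun x => c' x - c x) 1.
  rewrite q0 horner0 => ->; apply/eqP; apply: eq_peval => // x.
  by rewrite mul1r addrC subrK.
have [s [sD sq]] := line_nonroot c' Dc q0.
by exists (fun x => c x + s * (c' x - c x)); rewrite /= mulf_neq0 // -horner_pline.
Qed.

(** Full row rank is an open condition: with [Q] a right inverse of [M'], the determinant of
    [(M + s *: (M' - M)) *m Q] is a polynomial in [s] with value 1 at [s = 1]. *)
Lemma line_row_free (J : Type) (D : pexpr F J) (c c' : J -> F) (p m : nat)
    (M M' : 'M[F]_(p, m)) :
  peval id c D != 0 -> row_free M' ->
  exists s, peval id (fun x => c x + s * (c' x - c x)) D != 0 /\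
            row_free (M + s *: (M' - M)).
Proof.
move=> Dc /row_freeP[Q M'Q].
pose N : 'M[{poly F}]_p := map_mx polyC (M *m Q) + 'X *: map_mx polyC ((M' - M) *m Q).
have Ns s : (\det N).[s] = \det ((M + s *: (M' - M)) *m Q).
  rewrite -horner_evalE -det_map_mx; congr (\det _); apply/matrixP=> i j.
  rewrite /N (mulmxDl M) -scalemxAl; move: (M *m Q) ((M' - M) *m Q) => A B.
  by rewrite !mxE /= /horner_eval !hornerE.
have N0 : \det N != 0.
  apply: contraTneq (oner_neq0 F) => N0; have := Ns 1.
  by rewrite N0 horner0 scale1r addrC subrK M'Q det1 => <-; rewrite eqxx.
have [s [sD sN]] := line_nonroot c' Dc N0; exists s; split=> //.
have unit : (M + s *: (M' - M)) *m Q \in unitmx by rewrite unitmxE unitfE -Ns.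
by apply/row_freeP; exists (Q *m invmx ((M + s *: (M' - M)) *m Q)); rewrite mulmxA mulmxV.
Qed.

(* Choose the direction [c] so that [D] vanishes at [y] to the least possible
   order [r] along the line [y + s c].  By minimality the coefficients of order
   less than [r] of [D (y + T (c + S h (S)))] in [T] vanish for every value of
   [S], so the term of order [r] survives the substitution [S = T = s]. *)
Lemma curve_nonroot (J : Type) (D : pexpr F J) (y : J -> F)
    (h : (J -> F) -> J -> {poly F}) :
  (exists c, peval id c D != 0) ->
  exists c s, peval id (fun x => y x + s * c x + s ^+ 2 * (h c x).[s]) D != 0.
Proof.
move=> [c0 Dc0].
have ex_ord : exists r, `[< exists c, (pline D y c)`_r != 0 >].
  have p0 : pline D y (fun x => c0 x - y x) != 0.
    apply: contraNneq Dc0 => q0; have := horner_pline D y (fun x => c0 x - y x) 1.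
    rewrite q0 horner0 => ->; apply/eqP; apply: eq_peval => // x.
    by rewrite mul1r addrC subrK.
  exists (size (pline D y (fun x => c0 x - y x))).-1; apply/asboolP.
  by exists (fun x => c0 x - y x); rewrite -lead_coefE lead_coef_eq0.
have [r /asboolP[c Dcr] rmin] := ex_minnP ex_ord.
have low u i : (i < r)%N -> (pline D y u)`_i = 0.
  move=> ir; apply/eqP; apply: contraTT ir => ui; rewrite -leqNgt.
  by apply: rmin; apply/asboolP; exists u.
pose z x : {poly F} := (c x)%:P + 'X * h c x.
(* The outer variable is [T] and the inner one is [S], so evaluating the coefficients at [t]
   restricts [D] to the line through [y] with direction [z] at [t]. *)
pose Q : {poly {poly F}} := peval (polyC \o polyC)
   (fun x => (y x)%:P%:P + 'X * (z x)%:P) D.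
have Qt t : map_poly (horner_eval t) Q = pline D y (fun x => (z x).[t]).
  rewrite [LHS](peval_rmorph (map_poly (horner_eval t))); apply: eq_peval => x /=.
    by rewrite map_polyC /= /horner_eval hornerC.
  by rewrite rmorphD rmorphM /= map_polyX !map_polyC /= /horner_eval hornerC.
have Qlow i : (i < r)%N -> Q`_i = 0.
  move=> ir; apply: poly_fun_eq0 => t.
  by rewrite -[_.[t]](coef_map (horner_eval t)) Qt low.
have Qr : (Q`_r).[0] = (pline D y c)`_r.
  rewrite -[_.[0]](coef_map (horner_eval 0)) Qt; congr (nth _ (polyseq _) _); apply: eq_peval => // x.
  by rewrite /z !hornerE.
(* Evaluation at ['X] sets [T = S]. In degree [r], the terms with [i < r] vanish by [Qlow], those
   with [i > r] are divisible by a higher power of ['X], and [i = r] contributes the constant term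
   of its coefficient. *)
have Qdiag : Q.['X] != 0.
  apply: contraNneq Dcr => Q0; have : (Q.['X])`_r = 0 by rewrite Q0 coef0.
  rewrite horner_coef coef_sum -Qr.
  rewrite (eq_bigr (fun i : 'I_(size Q) => if i == r :> nat then (Q`_r).[0] else 0)).
    have [rQ|Qler] := ltnP r (size Q).
      rewrite (bigD1 (Ordinal rQ)) //= eqxx big1 ?addr0 => [->|i] //.
      by rewrite -val_eqE /= => /negPf->.
    by move=> _; rewrite nth_default // horner0.
  move=> i _; rewrite coefMXn; have [ri|ir|->] := ltngtP r i; first by [].
    by rewrite Qlow // coef0.
  by rewrite subnn horner_coef0.
have [s] := nonroot_ex Qdiag; exists c, s.
apply: contraNneq p => <-; apply/eqP.
rewrite -!horner_evalE [LHS](peval_rmorph (horner_eval s \o horner_eval 'X)).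
by apply: eq_peval => x /=; rewrite /horner_eval !hornerE //= expr2; ring.
Qed.

End ClosedField.

(** * Quantifier elimination and generic solvability *)

Section QE.
Variable F : closedFieldType.

Fixpoint term_of_pexpr (J : Type) (f : J -> nat) (D : pexpr F J) : GRing.term F :=
  match D with
  | PConst a => GRing.Const a
  | PVar x => GRing.Var F (f x)
  | PAdd D1 D2 => GRing.Add (term_of_pexpr f D1) (term_of_pexpr f D2)
  | PMul D1 D2 => GRing.Mul (term_of_pexpr f D1) (term_of_pexpr f D2)
  end.

Lemma eval_term_of_pexpr (J : Type) (f : J -> nat) (D : pexpr F J) e :
  GRing.eval e (term_of_pexpr f D) = peval id (fun x => e`_(f x)) D.
Proof. by elim: D => //= D1 -> D2 ->. Qed.

(** Beyond the end of [s] a variable becomes 0, the default that evaluation in the environment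
    [map c s] returns as well. *)
Fixpoint pexpr_of_term (J : Type) (s : seq J) (t : GRing.term F) : pexpr F J :=
  match t with
  | GRing.Var i => nth (PConst 0) (map PVar s) i
  | GRing.Const a => PConst a
  | GRing.NatConst n => PConst n%:R
  | GRing.Add t1 t2 => PAdd (pexpr_of_term s t1) (pexpr_of_term s t2)
  | GRing.Opp t1 => PMul (PConst (-1)) (pexpr_of_term s t1)
  | GRing.NatMul t1 n => PMul (PConst n%:R) (pexpr_of_term s t1)
  | GRing.Mul t1 t2 => PMul (pexpr_of_term s t1) (pexpr_of_term s t2)
  | GRing.Inv t1 => PConst 0
  | GRing.Exp t1 n => iter n (PMul (pexpr_of_term s t1)) (PConst 1)
  end.

Lemma peval_pexpr_of_term (J : Type) (s : seq J) (t : GRing.term F) (c : J -> F) :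
  GRing.rterm t -> peval id c (pexpr_of_term s t) = GRing.eval (map c s) t.
Proof.
elim: t => //=.
- by move=> i _; elim: s i => [|x s IHs] [|i] //=.
- by move=> t1 IH1 t2 IH2 /andP[/IH1-> /IH2->].
- by move=> t1 IH1 /IH1->; rewrite mulN1r.
- by move=> t1 IH1 n /IH1->; rewrite mulr_natl.
- by move=> t1 IH1 t2 IH2 /andP[/IH1-> /IH2->].
by move=> t1 IH1 n /IH1 E; elim: n => //= n ->; rewrite E exprS.
Qed.

(** An atom [t1 = t2] is always true if the difference vanishes everywhere; otherwise the difference
    serves as [D], off whose zeros the atom is false. Connectives multiply the polynomials of their
    arguments. *)
Lemma qf_generic (J : Type) (s : seq J) (f : GRing.formula F) :
  GRing.qf_form f -> GRing.rformula f ->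
  exists D : pexpr F J, (exists c, peval id c D != 0) /\
    forall c c', peval id c D != 0 -> peval id c' D != 0 ->
      GRing.qf_eval (map c s) f = GRing.qf_eval (map c' s) f.
Proof.
have bin f1 f2 (op : bool -> bool -> bool) :
    (exists D : pexpr F J, (exists c, peval id c D != 0) /\
      forall c c', peval id c D != 0 -> peval id c' D != 0 ->
      GRing.qf_eval (map c s) f1 = GRing.qf_eval (map c' s) f1) ->
    (exists D : pexpr F J, (exists c, peval id c D != 0) /\
      forall c c', peval id c D != 0 -> peval id c' D != 0 ->
      GRing.qf_eval (map c s) f2 = GRing.qf_eval (map c' s) f2) ->
    exists D : pexpr F J, (exists c, peval id c D != 0) /\
      forall c c', peval id c D != 0 -> peval id c' D != 0 ->
      op (GRing.qf_eval (map c s) f1) (GRing.qf_eval (map c s) f2) =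
      op (GRing.qf_eval (map c' s) f1) (GRing.qf_eval (map c' s) f2).
  move=> [D1 [nz1 D1P]] [D2 [nz2 D2P]]; exists (PMul D1 D2); split.
    exact: mul_nonzero.
  move=> c c' /=; rewrite !mulf_eq0 !negb_or => /andP[c1 c2] /andP[c1' c2'].
  by rewrite (D1P c c') // (D2P c c').
elim: f => //=.
- by move=> b _ _; exists (PConst 1); split=> //; exists (fun=> 0); rewrite oner_neq0.
- move=> t1 t2 _ /andP[r1 r2].
  pose D := PAdd (pexpr_of_term s t1) (PMul (PConst (-1)) (pexpr_of_term s t2)).
  have DE c : (GRing.eval (map c s) t1 == GRing.eval (map c s) t2) = (peval id c D == 0).
    by rewrite /D /= !peval_pexpr_of_term // mulN1r subr_eq0.
  have [nzD|zD] := pselect (exists c, peval id c D != 0).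
    by exists D; split=> // c c' Dc Dc'; rewrite !DE (negPf Dc) (negPf Dc').
  exists (PConst 1); split; first by exists (fun=> 0); rewrite /= oner_neq0.
  move=> c c' _ _; rewrite !DE; have zc c1 : peval id c1 D == 0.
    by apply: contraT => nz; case: zD; exists c1.
  by rewrite !zc.
- by move=> f1 IH1 f2 IH2 /andP[q1 q2] /andP[r1 r2]; apply: (bin _ _ andb); auto.
- by move=> f1 IH1 f2 IH2 /andP[q1 q2] /andP[r1 r2]; apply: (bin _ _ orb); auto.
- by move=> f1 IH1 f2 IH2 /andP[q1 q2] /andP[r1 r2]; apply: (bin _ _ implb); auto.
move=> f1 IH1 q1 r1; have [D [nz DP]] := IH1 q1 r1; exists D; split=> // c c' Dc Dc'.
by rewrite (DP c c').
Qed.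

Definition sumfun (A B C : Type) (f : A -> C) (g : B -> C) (x : A + B) : C :=
  match x with inl a => f a | inr b => g b end.

(* Solvability of a polynomial system is a first order property of its
   parameters, hence by quantifier elimination a Boolean combination of
   polynomial equations, each of which is constant off a proper closed set. *)
Lemma solvable_generic (J J' : finType) (l : seq (pexpr F (J + J'))) :
  exists D : pexpr F J, (exists c, peval id c D != 0) /\
    forall c c', peval id c D != 0 -> peval id c' D != 0 ->
      (exists u, all (fun E => peval id (sumfun c u) E == 0) l) ->
      exists u, all (fun E => peval id (sumfun c' u) E == 0) l.
Proof.
pose n := #|J|.
(* Parameters get the variables below [n] and unknowns the next ones, so that [map c (enum J)] is an
   environment for the parameters and the quantified variables are consecutive. *)
pose pos (x : J + J') : nat :=
  match x with inl x => index x (enum J) | inr x => (n + index x (enum J'))%N end.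
pose atoms := map (fun E => GRing.Equal (term_of_pexpr pos E) (GRing.Const 0)) l.
pose f0 := foldr (@GRing.And F) (@GRing.Bool F true) atoms.
pose f := foldr (@GRing.Exists F) f0 (iota n #|J'|).
have f0P e : GRing.holds e f0 <-> all (fun E => peval id (fun x => e`_(pos x)) E == 0) l.
  rewrite /f0 /atoms; elim: (l) => //= E l' IH; rewrite eval_term_of_pexpr.
  by split=> [[/eqP-> /IH]|/andP[/eqP-> /IH]].
have fP c : GRing.holds (map c (enum J)) f <->
    exists u, all (fun E => peval id (sumfun c u) E == 0) l.
  rewrite -GRing.foldExistsP; split.
    case=> e ee /f0P fe; exists (fun x => e`_(n + index x (enum J'))).
    apply: sub_all fe => E /eqP fE; apply/eqP; rewrite -[RHS]fE; apply: eq_peval => // -[x|x] //=.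
    rewrite -ee.
      by rewrite (nth_map x) ?nth_index ?index_mem ?mem_enum.
    rewrite !inE mem_iota negb_and -ltnNge; apply/orP; left.
    by rewrite /n cardE index_mem mem_enum.
  case=> u fu; pose e := map c (enum J) ++ map u (enum J').
  have szJ : size (map c (enum J)) = n by rewrite size_map -cardE.
  exists e.
    move=> i; rewrite !inE mem_iota negb_and -ltnNge -leqNgt => H.
    rewrite /GRing.same_env /e nth_cat szJ; case: ltnP => // ni.
    rewrite !nth_default ?szJ // size_map -cardE.
    by case/orP: H => // [|H]; [rewrite ltnNge ni | rewrite leq_subRL].
  apply/f0P; apply: sub_all fu => E /eqP fE; apply/eqP; rewrite -[RHS]fE; apply: eq_peval => // -[x|x] /=.
    by rewrite nth_cat szJ /n cardE index_mem mem_enum /= (nth_map x) ?nth_index ?index_mem ?mem_enum.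
  by rewrite nth_cat szJ ltnNge leq_addr /= addKn (nth_map x) ?nth_index ?index_mem ?mem_enum.
pose q := GRing.quantifier_elim (@ClosedFieldQE.ex_elim F) (GRing.to_rform f).
have /andP[qq rq] : GRing.qf_form q && GRing.rformula q.
  apply: GRing.quantifier_elim_wf; first exact: ClosedFieldQE.wf_ex_elim.
  exact: GRing.to_rform_rformula.
have qP e : reflect (GRing.holds e f) (GRing.qf_eval e q).
  have H := GRing.quantifier_elim_rformP (@ClosedFieldQE.wf_ex_elim F)
    (ClosedFieldQE.holds_ex_elim (@solve_monicpoly F)) e (GRing.to_rform_rformula f).
  by apply: (iffP H) => /GRing.to_rformP.
have [D [nzD DP]] := qf_generic (enum J) qq rq.
exists D; split=> // c c' Dc Dc' /fP/qP; rewrite (DP c c') // => /qP/fP.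
by [].
Qed.

Section PolySystems.
Variables (J J' : Type).
Implicit Types g : (J -> F) -> (J' -> F) -> F.

(** With its closure properties, this predicate shows matrix equations to be polynomial without
    their expressions being written out. *)
Definition polyfun g :=
  exists E : pexpr F (J + J'), forall c u, peval id (sumfun c u) E = g c u.

Lemma polyfun_const a : polyfun (fun _ _ => a).
Proof. by exists (PConst a). Qed.

Lemma polyfunD g g' : polyfun g -> polyfun g' -> polyfun (fun c u => g c u + g' c u).
Proof. by move=> [E EP] [E' EP']; exists (PAdd E E') => c u /=; rewrite EP EP'. Qed.

Lemma polyfunM g g' : polyfun g -> polyfun g' -> polyfun (fun c u => g c u * g' c u).
Proof. by move=> [E EP] [E' EP']; exists (PMul E E') => c u /=; rewrite EP EP'. Qed.

Lemma polyfun_sum (I : Type) (r : seq I) (g : I -> (J -> F) -> (J' -> F) -> F) :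
  (forall i, polyfun (g i)) -> polyfun (fun c u => \sum_(i <- r) g i c u).
Proof.
move=> gP; elim: r => [|i r IHr].
  by exists (PConst 0) => c u; rewrite big_nil.
have [E EP] := polyfunD (gP i) IHr; exists E => c u.
by rewrite big_cons EP.
Qed.

Definition polymx m n (M : (J -> F) -> (J' -> F) -> 'M[F]_(m, n)) :=
  forall i j, polyfun (fun c u => M c u i j).

Lemma polymxM m n p M N : @polymx m n M -> @polymx n p N ->
  polymx (fun c u => M c u *m N c u).
Proof.
move=> MP NP i j.
have [E EP] := polyfun_sum (index_enum 'I_n) (fun k => polyfunM (MP i k) (NP k j)).
by exists E => c u; rewrite EP mxE.
Qed.

Definition polysys (P : (J -> F) -> (J' -> F) -> Prop) :=
  exists l : seq (pexpr F (J + J')), forall c u,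
    P c u <-> all (fun E => peval id (sumfun c u) E == 0) l.

Lemma polysys_and P Q : polysys P -> polysys Q -> polysys (fun c u => P c u /\ Q c u).
Proof.
move=> [l lP] [l' lP']; exists (l ++ l') => c u; rewrite all_cat.
by split=> [[/lP-> /lP'->]|/andP[/lP ? /lP']].
Qed.

Lemma polysys_all (I : finType) (P : I -> (J -> F) -> (J' -> F) -> Prop) :
  (forall i, polysys (P i)) -> polysys (fun c u => forall i, P i c u).
Proof.
move=> PP; suff: polysys (fun c u => forall i, i \in enum I -> P i c u).
  by case=> l lP; exists l => c u; rewrite -lP; split=> H i *; apply: H; rewrite ?mem_enum.
elim: (enum I) => [|i r [l lP]]; first by exists [::].
have [l' lP'] := PP i; exists (l' ++ l) => c u; rewrite all_cat.
split=> [H|/andP[/lP' Pi /lP Pr] k].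
  apply/andP; split; first by apply/lP'/H; rewrite inE eqxx.
  by apply/lP => k kr; apply: H; rewrite inE kr orbT.
by rewrite inE => /predU1P[->|/Pr].
Qed.

Lemma polysys_mx m n (M : (J -> F) -> (J' -> F) -> 'M[F]_(m, n)) A :
  polymx M -> polysys (fun c u => M c u = A).
Proof.
move=> MP; suff [l lP] : polysys (fun c u => forall i j, M c u i j = A i j).
  exists l => c u; rewrite -lP; split=> [->//|H].
  by apply/matrixP.
apply: polysys_all => i; apply: polysys_all => j.
have [E EP] := polyfunD (MP i j) (polyfun_const (- A i j)).
exists [:: E] => c u /=; rewrite andbT EP subr_eq0.
by split=> [->|/eqP].
Qed.

End PolySystems.
End QE.

(** * Families of matrices as points of an affine space, and coordinate frames *)

Definition mxfam (I : Type) (m n : I -> nat) := {i : I & ('I_(m i) * 'I_(n i))%type}.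

Definition mxcoord (I : Type) (m n : I -> nat) (i : I) (p : 'I_(m i)) (q : 'I_(n i)) :
    mxfam m n :=
  Tagged (fun i => 'I_(m i) * 'I_(n i))%type (p, q).

Definition mx_of (F I : Type) (m n : I -> nat) (c : mxfam m n -> F) (i : I) :
    'M[F]_(m i, n i) :=
  \matrix_(p, q) c (mxcoord p q).

Definition of_mx (F I : Type) (m n : I -> nat) (M : forall i, 'M[F]_(m i, n i))
    (x : mxfam m n) : F :=
  M (tag x) (tagged x).1 (tagged x).2.

Lemma of_mxK (F I : Type) (m n : I -> nat) (M : forall i, 'M[F]_(m i, n i)) i :
  mx_of (of_mx M) i = M i.
Proof. by apply/matrixP=> p q; rewrite mxE. Qed.

Lemma dep_choice (I : Type) (T : I -> Type) (Q : forall i, T i -> Prop) :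
  (forall i, exists x, Q i x) -> exists f, forall i, Q i (f i).
Proof. by move=> ex; exists (fun i => sval (cid (ex i))) => i; case: cid. Qed.

(** The inequality leaves room for disjoint sets of coordinates: [d] of them for [P] and [e] for
    each [t] in [A]. All four kinds of matrices are 0/1 selections of these coordinates. *)
Lemma frame_ex (F : fieldType) (T : finType) (A : {set T}) (d e n : nat) :
  (d + #|A| * e <= n)%N ->
  exists (P : 'M[F]_(d, n)) (P' : 'M[F]_(n, d))
         (R : T -> 'M[F]_(n, e)) (S : T -> 'M[F]_(e, n)),
    [/\ P *m P' = 1%:M, (forall t, P *m R t = 0), (forall t, S t *m P' = 0) &
        forall t t', t \in A -> S t' *m R t = (t' == t)%:R%:M].
Proof.
move=> le_n; pose X : finType := ('I_d + {t | t \in A} * 'I_e)%type.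
have cX : #|X| = (d + #|A| * e)%N by rewrite card_sum card_prod !card_ord card_sig.
have leX : (#|X| <= n)%N by rewrite cX.
have [f f_inj] : exists f : X -> 'I_n, injective f.
  exists (fun x => widen_ord leX (enum_rank x)).
  by move=> x y /(congr1 val) /= /val_inj /enum_rank_inj.
(* For [t] outside [A] the value is [None], which [sel] turns into a zero row. *)
pose g (t : T) (q : 'I_e) : option 'I_n := omap (fun t' => f (inr (t', q))) (insub t).
pose sel m (h : 'I_m -> option 'I_n) : 'M[F]_(m, n) :=
  \matrix_(p, i) (h p == Some i)%:R.
have selM m m' (h : 'I_m -> option 'I_n) (h' : 'I_m' -> option 'I_n) p q :
    (sel _ h *m (sel _ h')^T) p q = ((h p == h' q) && (h p != None))%:R.
  rewrite mxE; case hp: (h p) => [i|]; last first.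
    rewrite andbF big1 // => j _; rewrite !mxE hp (_ : None == _ = false) //.
    by rewrite mul0r.
  rewrite (bigD1 i) //= !mxE hp eqxx mul1r big1 ?addr0 => [|j ji].
    by rewrite andbT eq_sym.
  rewrite !mxE hp (_ : Some i == Some j = false) ?mul0r //.
  by apply/negbTE; apply: contra ji => /eqP[->].
pose h0 (p : 'I_d) := Some (f (inl p)).
exists (sel _ h0), (sel _ h0)^T, (fun t => (sel _ (g t))^T), (fun t => sel _ (g t)).
have g0 t q p : g t q == Some (f (inl p)) = false.
  by rewrite /g; case: insubP => //= u _ _; apply/negbTE/eqP => -[/f_inj].
split.
- apply/matrixP=> p q; rewrite selM /h0 !mxE andbT.
  by congr (nat_of_bool _)%:R; apply/eqP/eqP => [[/f_inj[]]|->].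
- by move=> t; apply/matrixP=> p q; rewrite selM !mxE /h0 eq_sym g0.
- by move=> t; apply/matrixP=> p q; rewrite selM !mxE /h0 g0.
move=> t t' tA; apply/matrixP=> p q; rewrite selM !mxE /g (insubT (fun t => t \in A) tA) /=.
case: insubP => [u _ ut'|t'A] /=; last first.
  by case: eqP t'A => [->|]; rewrite ?tA // mul0rn.
rewrite andbT -ut' -mulrnA mulnb; congr (nat_of_bool _)%:R.
apply/eqP/andP => [[/f_inj[-> ->]]|[/eqP utt /eqP->]]; first by rewrite !eqxx.
by congr (Some (f (inr (_, _)))); apply: val_inj.
Qed.

(** * The alignment equations and their solvability for a generic channel *)

Section Alignment.
Variables (F : closedFieldType) (K L Ma Mb : nat) (Na : 'I_K -> nat) (Nb : 'I_L -> nat).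
Variables (da db : nat).

Definition chan : finType :=
  (mxfam Na (fun=> Ma) +
  (mxfam (fun kl : 'I_K * 'I_L => Na kl.1) (fun kl => Nb kl.2) +
  (mxfam (fun _ : 'I_L => Mb) Nb +
   mxfam (fun _ : unit => Mb) (fun=> Ma))))%type.

Definition filt : finType :=
  (mxfam (fun=> da) Na + (mxfam Nb (fun=> db) +
  (mxfam (fun _ : 'I_K => Ma) (fun=> da) + mxfam (fun _ : 'I_L => db) (fun=> Mb))))%type.

Implicit Types (c : chan -> F) (u : filt -> F).

Definition chHa c k : 'M[F]_(Na k, Ma) := mx_of (fun x => c (inl x)) k.
Definition chGa c k l : 'M[F]_(Na k, Nb l) := mx_of (fun x => c (inr (inl x))) (k, l).
Definition chHb c l : 'M[F]_(Mb, Nb l) := mx_of (fun x => c (inr (inr (inl x)))) l.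
Definition chGb c : 'M[F]_(Mb, Ma) := mx_of (fun x => c (inr (inr (inr x)))) tt.

Definition mkchan (Ha : forall k, 'M[F]_(Na k, Ma)) (Ga : forall k l, 'M[F]_(Na k, Nb l))
    (Hb : forall l, 'M[F]_(Mb, Nb l)) (Gb : 'M[F]_(Mb, Ma)) : chan -> F :=
  sumfun (of_mx Ha) (sumfun (of_mx (fun kl => Ga kl.1 kl.2))
    (sumfun (of_mx Hb) (of_mx (fun _ : unit => Gb)))).

Lemma chHaE Ha Ga Hb Gb k : chHa (mkchan Ha Ga Hb Gb) k = Ha k.
Proof. exact: of_mxK. Qed.
Lemma chGaE Ha Ga Hb Gb k l : chGa (mkchan Ha Ga Hb Gb) k l = Ga k l.
Proof. by apply/matrixP=> p q; rewrite mxE. Qed.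
Lemma chHbE Ha Ga Hb Gb l : chHb (mkchan Ha Ga Hb Gb) l = Hb l.
Proof. exact: of_mxK. Qed.
Lemma chGbE Ha Ga Hb Gb : chGb (mkchan Ha Ga Hb Gb) = Gb.
Proof. exact: of_mxK. Qed.

(* [W] and [X] are the conjugate transposes of the receive filters; the rank
   conditions are normalised to identity matrices so that only equations remain. *)
Definition aligned_by (Ha : forall k, 'M[F]_(Na k, Ma)) (Ga : forall k l, 'M[F]_(Na k, Nb l))
    (Hb : forall l, 'M[F]_(Mb, Nb l)) (Gb : 'M[F]_(Mb, Ma))
    (W : forall k, 'M[F]_(da, Na k)) (V : forall l, 'M[F]_(Nb l, db))
    (A : 'I_K -> 'M[F]_(Ma, da)) (X : 'I_L -> 'M[F]_(db, Mb)) : Prop :=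
  ((forall k l, W k *m Ga k l *m V l = 0) /\
   (forall k l, X l *m Gb *m A k = 0)) /\
  ((forall k i, W k *m Ha k *m A i = (k == i)%:R%:M) /\
   (forall l j, X l *m Hb j *m V j = (l == j)%:R%:M)).

Definition aligned c u : Prop :=
  aligned_by (chHa c) (chGa c) (chHb c) (chGb c)
    (mx_of (fun x => u (inl x))) (mx_of (fun x => u (inr (inl x))))
    (mx_of (fun x => u (inr (inr (inl x))))) (mx_of (fun x => u (inr (inr (inr x))))).

Lemma aligned_polysys : polysys aligned.
Proof.
have pHa k : polymx (fun c (u : filt -> F) => chHa c k).
  by move=> i j; exists (PVar (inl (inl (@mxcoord _ Na (fun=> Ma) k i j)))) => c u; rewrite mxE.
have pGa k l : polymx (fun c (u : filt -> F) => chGa c k l).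
  by move=> i j; exists (PVar (inl (inr (inl
    (@mxcoord _ (fun kl => Na kl.1) (fun kl => Nb kl.2) (k, l) i j))))) => c u; rewrite mxE.
have pHb l : polymx (fun c (u : filt -> F) => chHb c l).
  by move=> i j; exists (PVar (inl (inr (inr (inl (@mxcoord _ (fun=> Mb) Nb l i j)))))) => c u; rewrite mxE.
have pGb : polymx (fun c (u : filt -> F) => chGb c).
  by move=> i j; exists (PVar (inl (inr (inr (inr (@mxcoord _ (fun=> Mb) (fun=> Ma) tt i j)))))) => c u; rewrite mxE.
have pU I m n (f : mxfam m n -> filt) (i : I) :
    polymx (fun (c : chan -> F) u => mx_of (fun x => u (f x)) i).
  by move=> p q; exists (PVar (inr (f (mxcoord p q)))) => c u; rewrite mxE.
have pW := pU _ _ _ (fun x => inl x).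
have pV := pU _ _ _ (fun x => inr (inl x)).
have pA := pU _ _ _ (fun x => inr (inr (inl x))).
have pX := pU _ _ _ (fun x => inr (inr (inr x))).
apply: polysys_and; apply: polysys_and; apply: polysys_all => i;
  apply: polysys_all => j; apply: polysys_mx.
- exact: (polymxM (polymxM (pW i) (pGa i j)) (pV j)).
- exact: (polymxM (polymxM (pX j) pGb) (pA i)).
- exact: (polymxM (polymxM (pW i) (pHa i)) (pA j)).
- exact: (polymxM (polymxM (pX i) (pHb j)) (pV j)).
Qed.

Lemma aligned_byP c :
  (exists W V A X, aligned_by (chHa c) (chGa c) (chHb c) (chGb c) W V A X) <->
  exists u, aligned c u.
Proof.
split=> [[W [V [A [X H]]]]|[u H]]; last by do 4!eexists; exact: H.
exists (sumfun (of_mx W) (sumfun (of_mx V) (sumfun (of_mx A) (of_mx X)))).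
have EW := of_mxK W; have EV := of_mxK V; have EA := of_mxK A; have EX := of_mxK X.
by case: H => [[H1 H2] [H3 H4]]; split; split=> ? ?;
  rewrite (EW, EX) (EV, EA) ?(H1, H2, H3, H4).
Qed.

(** Membership in [O] means that receiver [k] owns the edge; the other edges belong to [l]. The
    one-sided inverses [W'] and [V'] are kept because they later allow the products of [W] and [V]
    with the direct channels to be prescribed. *)
Lemma aligned_interference (O : {set 'I_K * 'I_L}) :
  (forall k, da + #|[set l | (k, l) \in O]| * db <= Na k)%N ->
  (forall l, db + #|[set k | (k, l) \notin O]| * da <= Nb l)%N ->
  forall D : pexpr F chan, (exists c, peval id c D != 0) ->
  exists2 c, peval id c D != 0 &
    exists (W : forall k, 'M[F]_(da, Na k)) (W' : forall k, 'M[F]_(Na k, da))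
           (V : forall l, 'M[F]_(Nb l, db)) (V' : forall l, 'M[F]_(db, Nb l)),
      [/\ forall k l, W k *m chGa c k l *m V l = 0,
          forall k, W k *m W' k = 1%:M & forall l, V' l *m V l = 1%:M].
Proof.
move=> leNa leNb D nzD.
have [P /dep_choice[P' /dep_choice[R /dep_choice[S PRS]]]] :=
  dep_choice (fun k => frame_ex F (leNa k)).
have [Q' /dep_choice[Q /dep_choice[R' /dep_choice[S' QRS]]]] :=
  dep_choice (fun l => frame_ex F (leNb l)).
(* Each [G0 k l] is killed between [P k] and [Q l]. At an edge in [O], varying the receive filter
   along [S k l] changes the product freely; at any other edge, varying the transmit filter along
   [R' l k] does. *)
pose G0 k l : 'M[F]_(Na k, Nb l) :=
  if (k, l) \in O then R k l *m Q' l else P' k *m S' l k.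
pose N c k l := P k *m chGa c k l *m Q l.
(* First order corrections: the owner of each edge cancels [N c k l]. The frame relations keep the
   corrections for different edges from interfering. *)
pose W1 c k := - \sum_(l | (k, l) \in O) N c k l *m S k l.
pose V1 c l := - \sum_(k | (k, l) \notin O) R' l k *m N c k l.
have PP' k : P k *m P' k = 1%:M by case: (PRS k).
have PR k l : P k *m R k l = 0 by case: (PRS k).
have SP' k l : S k l *m P' k = 0 by case: (PRS k).
have SR k l l' : (k, l) \in O -> S k l' *m R k l = (l' == l)%:R%:M.
  by move=> kl; case: (PRS k) => _ _ _; apply; rewrite inE.
have QQ l : Q' l *m Q l = 1%:M by case: (QRS l).
have QR l k : Q' l *m R' l k = 0 by case: (QRS l).
have SQ l k : S' l k *m Q l = 0 by case: (QRS l).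
have SR' l k k' : (k, l) \notin O -> S' l k' *m R' l k = (k' == k)%:R%:M.
  by move=> kl; case: (QRS l) => _ _ _; apply; rewrite inE.
have W1P' c k : W1 c k *m P' k = 0.
  rewrite mulNmx mulmx_suml big1 ?oppr0 // => l _.
  by rewrite -mulmxA SP' mulmx0.
have QV1 c l : Q' l *m V1 c l = 0.
  rewrite mulmxN mulmx_sumr big1 ?oppr0 // => k _.
  by rewrite mulmxA QR mul0mx.
have order0 k l : P k *m G0 k l *m Q l = 0.
  rewrite /G0; case: ifP => _; rewrite -mulmxA; last by rewrite -mulmxA SQ !mulmx0.
  by rewrite -mulmxA mulmxA PR mul0mx.
have order1 c k l :
    W1 c k *m G0 k l *m Q l + P k *m chGa c k l *m Q l + P k *m G0 k l *m V1 c l = 0.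
  rewrite -/(N c k l) /G0; case: ifPn => kl.
    rewrite [P k *m (R k l *m _)]mulmxA PR !mul0mx addr0 -!mulmxA QQ mulmx1.
    rewrite mulNmx mulmx_suml (bigD1 l) //= -mulmxA SR // eqxx mulmx1.
    rewrite big1 ?addr0 ?addNr // => l' /andP[_ ll'].
    by rewrite -mulmxA SR // (negPf ll') mul_mx_scalar scale0r.
  rewrite [W1 c k *m (_ *m _)]mulmxA W1P' !mul0mx add0r.
  rewrite [P k *m (P' k *m _)]mulmxA PP' mul1mx.
  rewrite mulmxN mulmx_sumr (bigD1 k) //= mulmxA SR' // eqxx mul1mx.
  rewrite big1 ?addr0 ?subrr // => k' /andP[k'l kk'].
  by rewrite mulmxA SR' // eq_sym (negPf kk') mul_scalar_mx scale0r.
(* [E0] and [E1] are the coefficients of [s ^+ 2] and [s ^+ 3] in the product of [P + s W1],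
   [G0 + s C] and [Q + s V1], where [C] is the interference part of [c]. *)
pose E0 c k l : 'M[F]_(da, db) :=
  W1 c k *m G0 k l *m V1 c l + W1 c k *m chGa c k l *m Q l + P k *m chGa c k l *m V1 c l.
pose E1 c k l : 'M[F]_(da, db) := W1 c k *m chGa c k l *m V1 c l.
pose y : chan -> F := mkchan (fun=> 0) G0 (fun=> 0) 0.
(* The remaining error is removed by changing the channel itself: since [W1] kills [P'] and [Q']
   kills [V1], a term [P' E Q'] between the corrected filters gives exactly [E]. *)
pose h c : chan -> {poly F} := fun x => match x with
  | inr (inl z) =>
      (- of_mx (fun kl => P' kl.1 *m E0 c kl.1 kl.2 *m Q' kl.2) z)%:P +
      (- of_mx (fun kl => P' kl.1 *m E1 c kl.1 kl.2 *m Q' kl.2) z)%:P * 'X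
  | _ => 0 end.
have [c [s Dcs]] := curve_nonroot y h nzD.
exists (fun x => y x + s * c x + s ^+ 2 * (h c x).[s]) => //.
exists (fun k => P k + s *: W1 c k), P', (fun l => Q l + s *: V1 c l), Q'.
split=> [k l|k|l]; last first.
- by rewrite mulmxDr -scalemxAr QV1 scaler0 addr0 QQ.
- by rewrite mulmxDl -scalemxAl W1P' scaler0 addr0 PP'.
have WP' : (P k + s *: W1 c k) *m P' k = 1%:M.
  by rewrite mulmxDl -scalemxAl W1P' scaler0 addr0 PP'.
have VQ' : Q' l *m (Q l + s *: V1 c l) = 1%:M.
  by rewrite mulmxDr -scalemxAr QV1 scaler0 addr0 QQ.
pose E := E0 c k l + s *: E1 c k l.
have -> : chGa (fun x => y x + s * c x + s ^+ 2 * (h c x).[s]) k l =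
    G0 k l + s *: chGa c k l - s ^+ 2 *: (P' k *m E *m Q' l).
  rewrite /E mulmxDr mulmxDl -scalemxAr -scalemxAl.
  apply/matrixP=> p q; have := chGaE (fun=> 0) G0 (fun=> 0) 0 k l.
  move/matrixP/(_ p q); rewrite -/y mxE => yE.
  rewrite [LHS]mxE yE /h /of_mx /= !hornerE.
  move: (P' k *m E0 c k l *m Q' l) (P' k *m E1 c k l *m Q' l) => A B.
  by rewrite !mxE; ring.
set W := P k + _ in WP' *; set V := Q l + _ in VQ' *.
have corr : W *m (P' k *m E *m Q' l) *m V = E.
  by rewrite !mulmxA WP' mul1mx -mulmxA VQ' mulmx1.
rewrite mulmxBr mulmxBl -[W *m (s ^+ 2 *: _)]scalemxAr -[(s ^+ 2 *: _) *m V]scalemxAl corr.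
rewrite /W /V {W V corr WP' VQ'}.
have := order1 c k l; have := order0 k l; rewrite /E /E0 /E1.
rewrite !(mulmxDl, mulmxDr) -!(scalemxAl, scalemxAr).
move: (P k *m G0 k l *m Q l) (W1 c k *m G0 k l *m Q l) (P k *m chGa c k l *m Q l)
  (P k *m G0 k l *m V1 c l) (W1 c k *m G0 k l *m V1 c l) (W1 c k *m chGa c k l *m Q l)
  (P k *m chGa c k l *m V1 c l) (W1 c k *m chGa c k l *m V1 c l).
move=> a b d e a1 a2 a3 a4 -> bde.
apply/matrixP=> p q; move/matrixP/(_ p q): bde; rewrite !mxE => bde.
by rewrite -[RHS](mulr0 s) -[in RHS]bde; ring.
Qed.

Definition chline (c c' : chan -> F) (s : F) : chan -> F :=
  fun x => c x + s * (c' x - c x).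

Lemma chHa_line c c' s k : chHa (chline c c' s) k = chHa c k + s *: (chHa c' k - chHa c k).
Proof. by apply/matrixP=> i j; rewrite !mxE. Qed.
Lemma chGa_line c c' s k l :
  chGa (chline c c' s) k l = chGa c k l + s *: (chGa c' k l - chGa c k l).
Proof. by apply/matrixP=> i j; rewrite !mxE. Qed.
Lemma chHb_line c c' s l : chHb (chline c c' s) l = chHb c l + s *: (chHb c' l - chHb c l).
Proof. by apply/matrixP=> i j; rewrite !mxE. Qed.
Lemma chGb_line c c' s : chGb (chline c c' s) = chGb c + s *: (chGb c' - chGb c).
Proof. by apply/matrixP=> i j; rewrite !mxE. Qed.

Lemma row_free_pid (p m : nat) : (p <= m)%N -> row_free (pid_mx p : 'M[F]_(p, m)).
Proof. by move=> pm; rewrite /row_free rank_pid_mx. Qed.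

Lemma submxblock1 (q r : nat) (i j : 'I_q) :
  submxblock (1%:M : 'M[F]_(\sum_(k < q) r)) i j = (i == j)%:R%:M.
Proof.
rewrite -mxdiagZ mxblockK; have [_|_] := eqVneq i j; last by rewrite raddf0.
by rewrite conform_mx_id.
Qed.

Lemma submxcolZ (q r m : nat) (a : F) (B : 'M[F]_(\sum_(k < q) r, m)) i :
  submxcol (a *: B) i = a *: submxcol B i.
Proof. by apply/matrixP=> ? ?; rewrite !mxE. Qed.

Lemma submxrowZ (q r m : nat) (a : F) (B : 'M[F]_(m, \sum_(k < q) r)) i :
  submxrow (a *: B) i = a *: submxrow B i.
Proof. by apply/matrixP=> ? ?; rewrite !mxE. Qed.

(** * Zero forcing at the two base stations by inverting stacked channels *)

Section Stacked.
Variables (W : forall k, 'M[F]_(da, Na k)) (W' : forall k, 'M[F]_(Na k, da)).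
Variables (V : forall l, 'M[F]_(Nb l, db)) (V' : forall l, 'M[F]_(db, Nb l)).
Hypotheses (WW' : forall k, W k *m W' k = 1%:M) (VV' : forall l, V' l *m V l = 1%:M).

Definition stackA c : 'M[F]_(\sum_(k < K) da, Ma) := \mxcol_k (W k *m chHa c k).
Definition stackB c : 'M[F]_(Mb, \sum_(l < L) db) := \mxrow_l (chHb c l *m V l).

Lemma stackA_line c c' s :
  stackA (chline c c' s) = stackA c + s *: (stackA c' - stackA c).
Proof.
apply/mxcolP => k; rewrite submxcolD submxcolZ submxcolB !mxcolK chHa_line.
by rewrite mulmxDr -scalemxAr mulmxBr.
Qed.

Lemma stackB_line c c' s :
  stackB (chline c c' s) = stackB c + s *: (stackB c' - stackB c).
Proof.
apply/mxrowP => l; rewrite submxrowD submxrowZ submxrowB !mxrowK chHb_line.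
by rewrite mulmxDl -scalemxAl mulmxBl.
Qed.

Lemma stackA_mk A Ga Hb Gb :
  stackA (mkchan (fun k => W' k *m submxcol A k) Ga Hb Gb) = A.
Proof. by apply/mxcolP => k; rewrite mxcolK chHaE mulmxA WW' mul1mx. Qed.

Lemma stackB_mk B Ha Ga Gb :
  stackB (mkchan Ha Ga (fun l => submxrow B l *m V' l) Gb) = B.
Proof. by apply/mxrowP => l; rewrite mxrowK chHbE -mulmxA VV' mulmx1. Qed.

(** The blocks of the identity matrix encode at once the vanishing of intra-cell interference and
    the normalised rank conditions. *)
Lemma aligned_stack c A X :
  (forall k l, W k *m chGa c k l *m V l = 0) ->
  stackA c *m A = 1%:M -> X *m stackB c = 1%:M -> X *m chGb c *m A = 0 ->
  exists u, aligned c u.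
Proof.
move=> WGV WA XV XGA; apply/aligned_byP.
exists W, V, (fun k => submxrow A k), (fun l => submxcol X l).
split; split=> //.
- by move=> k l; rewrite mul_submxrow submxcol_mul submxcol_mul XGA submxcol0 submxrow0.
- move=> k i; rewrite -submxblock1 -WA submxblockEv mul_submxrow.
  by rewrite -submxcol_mul mxcolK.
move=> l j; rewrite -submxblock1 -XV submxblockEh -mulmxA submxcol_mul.
by rewrite -mul_submxrow mxrowK.
Qed.

(** The smaller side is inverted first; the larger base station then has room to invert its own
    stack and to null the interference between the base stations. Every move follows a line that
    leaves [chGa] fixed and keeps [D] nonzero. *)
Lemma aligned_stack_ex (D : pexpr F chan) c :
  (K * da <= Ma)%N -> (L * db <= Mb)%N -> (K * da + L * db <= maxn Ma Mb)%N ->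
  peval id c D != 0 -> (forall k l, W k *m chGa c k l *m V l = 0) ->
  exists2 c', peval id c' D != 0 & exists u, aligned c' u.
Proof.
have -> : (K * da = \sum_(k < K) da)%N by rewrite sum_nat_const card_ord.
have -> : (L * db = \sum_(l < L) db)%N by rewrite sum_nat_const card_ord.
set p := (\sum_(k < K) da)%N; set q := (\sum_(l < L) db)%N.
move=> pMa qMb; rewrite leq_max => /orP[pqM|pqM] Dc WGV.
- pose c1 := mkchan (chHa c) (chGa c)
    (fun l => submxrow ((pid_mx q : 'M[F]_(q, Mb))^T) l *m V' l) (chGb c).
  have [|s [Ds]] := line_row_free (M' := (stackB c1)^T) c1 (stackB c)^T Dc.
    by rewrite stackB_mk trmxK row_free_pid.
  rewrite -linearB -linearZ -linearD -stackB_line; set c2 := chline c c1 s.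
  case/row_freeP=> Y /(congr1 trmx); rewrite trmx_mul trmxK trmx1.
  set X := Y^T => XB.
  have Ga2 k l : chGa c2 k l = chGa c k l.
    by rewrite chGa_line chGaE subrr scaler0 addr0.
  pose Z c := col_mx (stackA c) (X *m chGb c).
  pose Z0 : 'M[F]_(p + q, Ma) := pid_mx (p + q).
  (* The target of the second move: as [X] is a left inverse of [stackB c2], this choice of [chGb]
     gives [Z c3 = Z0], of full row rank. Keeping [chHb] preserves that left inverse. *)
  pose c3 := mkchan (fun k => W' k *m submxcol (usubmx Z0) k) (chGa c2) (chHb c2)
    (stackB c2 *m dsubmx Z0).
  have Z3 : Z c3 = Z0.
    by rewrite /Z stackA_mk chGbE mulmxA XB mul1mx vsubmxK.
  have [|t [Dt]] := line_row_free (M' := Z c3) c3 (Z c2) Ds.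
    by rewrite Z3 row_free_pid.
  have -> : Z c2 + t *: (Z c3 - Z c2) = Z (chline c2 c3 t).
    rewrite /Z stackA_line chGb_line opp_col_mx add_col_mx scale_col_mx add_col_mx.
    by rewrite mulmxDr -scalemxAr mulmxBr.
  set c4 := chline c2 c3 t; case/row_freeP=> A ZA.
  exists c4 => //.
  have : col_mx (stackA c4 *m lsubmx A) (X *m chGb c4 *m lsubmx A) = col_mx 1%:M 0.
    rewrite -mul_col_mx -/(Z c4) mulmx_lsub ZA scalar_mx_block block_mxEh.
    by rewrite row_mxKl.
  case/eq_col_mx => WA XGA; apply: (aligned_stack _ WA _ XGA).
    by move=> k l; rewrite chGa_line chGaE subrr scaler0 addr0 Ga2.
  suff -> : stackB c4 = stackB c2 by [].
  by apply/mxrowP=> l; rewrite !mxrowK chHb_line chHbE subrr scaler0 addr0.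
- pose c1 := mkchan (fun k => W' k *m submxcol (pid_mx p : 'M[F]_(p, Ma)) k) (chGa c)
    (chHb c) (chGb c).
  have [|s [Ds]] := line_row_free (M' := stackA c1) c1 (stackA c) Dc.
    by rewrite stackA_mk row_free_pid.
  rewrite -stackA_line; set c2 := chline c c1 s.
  case/row_freeP=> A WA.
  have Ga2 k l : chGa c2 k l = chGa c k l.
    by rewrite chGa_line chGaE subrr scaler0 addr0.
  pose Z c := row_mx (chGb c *m A) (stackB c).
  pose Z0 : 'M[F]_(Mb, p + q) := (pid_mx (p + q))^T.
  (* The dual choice: [A] is a right inverse of [stackA c2], hence [chGb c3 *m A] is the left part
     of [Z0]. *)
  pose c3 := mkchan (chHa c2) (chGa c2) (fun l => submxrow (rsubmx Z0) l *m V' l)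
    (lsubmx Z0 *m stackA c2).
  have Z3 : Z c3 = Z0.
    by rewrite /Z stackB_mk chGbE -mulmxA WA mulmx1 hsubmxK.
  have [|t [Dt]] := line_row_free (M' := (Z c3)^T) c3 (Z c2)^T Ds.
    by rewrite Z3 trmxK row_free_pid.
  have -> : (Z c2)^T + t *: ((Z c3)^T - (Z c2)^T) = (Z (chline c2 c3 t))^T.
    rewrite -linearB -linearZ -linearD /Z stackB_line chGb_line.
    rewrite opp_row_mx add_row_mx scale_row_mx add_row_mx.
    by rewrite mulmxDl -scalemxAl mulmxBl.
  set c4 := chline c2 c3 t; case/row_freeP=> Y /(congr1 trmx).
  rewrite trmx_mul trmxK trmx1; set X := Y^T => XZ.
  exists c4 => //.
  have : row_mx (dsubmx X *m (chGb c4 *m A)) (dsubmx X *m stackB c4) = row_mx 0 1%:M.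
    rewrite -mul_mx_row -/(Z c4) mul_dsub_mx XZ scalar_mx_block /block_mx.
    by rewrite col_mxKd.
  case/eq_row_mx => XGA XB.
  apply: (aligned_stack (A := A) _ _ XB); last by rewrite -mulmxA.
    by move=> k l; rewrite chGa_line chGaE subrr scaler0 addr0 Ga2.
  suff -> : stackA c4 = stackA c2 by [].
  by apply/mxcolP=> k; rewrite !mxcolK chHa_line chHaE subrr scaler0 addr0.
Qed.

End Stacked.

Theorem aligned_generic (O : {set 'I_K * 'I_L}) :
  (forall k, da + #|[set l | (k, l) \in O]| * db <= Na k)%N ->
  (forall l, db + #|[set k | (k, l) \notin O]| * da <= Nb l)%N ->
  (K * da <= Ma)%N -> (L * db <= Mb)%N -> (K * da + L * db <= maxn Ma Mb)%N ->
  exists D : pexpr F chan, (exists c, peval id c D != 0) /\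
    forall c, peval id c D != 0 -> exists u, aligned c u.
Proof.
move=> leNa leNb pMa qMb pqM; have [l lP] := aligned_polysys.
have [D [nzD DP]] := solvable_generic l; exists D; split=> // c Dc.
have [c1 Dc1 [W [W' [V [V' [WGV WW' VV']]]]]] := aligned_interference leNa leNb nzD.
have [c2 Dc2 [u /lP lu]] := aligned_stack_ex WW' VV' pMa qMb pqM Dc1 WGV.
have [u' lu'] := DP _ _ Dc2 Dc (ex_intro _ u lu).
by exists u'; apply/lP.
Qed.

End Alignment.

(** Singletons in [cut] show that the differences are nonnegative, so by the congruences they are
    natural multiples of [db] and [da]. Dividing [cut] by [da * db] leaves the orientation condition
    for the complete bipartite graph. *)
Lemma owner_ex (K L : nat) (Na : 'I_K -> nat) (Nb : 'I_L -> nat) (da db : nat) :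
  (0 < da)%N -> (0 < db)%N ->
  (forall k : 'I_K, (((Na k)%:Z - da%:Z) %% db%:Z)%Z = 0) ->
  (forall l : 'I_L, (((Nb l)%:Z - db%:Z) %% da%:Z)%Z = 0) ->
  (forall (Ia : {set 'I_K}) (Ib : {set 'I_L}),
     (#|Ia| * #|Ib| * da * db)%:Z <=
       \sum_(k in Ia) da%:Z * ((Na k)%:Z - da%:Z)
       + \sum_(l in Ib) db%:Z * ((Nb l)%:Z - db%:Z)) ->
  exists O : {set 'I_K * 'I_L},
    (forall k, da + #|[set l | (k, l) \in O]| * db <= Na k)%N /\
    (forall l, db + #|[set k | (k, l) \notin O]| * da <= Nb l)%N.
Proof.
move=> da0 db0 modNa modNb cut.
have leNa k : (da <= Na k)%N.
  have := cut [set k] set0; rewrite big_set1 big_set0 cards0 muln0 !mul0n addr0.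
  by rewrite pmulr_rge0 ?ltz_nat // subr_ge0 lez_nat.
have leNb l : (db <= Nb l)%N.
  have := cut set0 [set l]; rewrite big_set1 big_set0 cards0 !mul0n add0r.
  by rewrite pmulr_rge0 ?ltz_nat // subr_ge0 lez_nat.
pose a k := ((Na k - da) %/ db)%N; pose b l := ((Nb l - db) %/ da)%N.
have Na_a k : (Na k = da + a k * db)%N.
  have := modNa k; rewrite subzn // modz_nat => -[/eqP dv].
  by rewrite divnK // subnKC.
have Nb_b l : (Nb l = db + b l * da)%N.
  have := modNb l; rewrite subzn // modz_nat => -[/eqP dv].
  by rewrite divnK // subnKC.
have [|O [Oa Ob]] := @edge_orientation _ _ [set: 'I_K * 'I_L] a b.
  move=> A B; rewrite setTI cardsX.
  have := cut A B.
  rewrite (eq_bigr (fun k => ((da * db) * a k)%:Z)); last first.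
    by move=> k _; rewrite subzn // Na_a addKn -PoszM mulnCA mulnC (mulnC da).
  rewrite [\sum_(l in B) _](eq_bigr (fun l => ((da * db) * b l)%:Z)); last first.
    by move=> l _; rewrite subzn // Nb_b addKn -PoszM (mulnC (b l)) mulnA (mulnC da).
  rewrite -!(big_morph Posz PoszD (erefl _)) -PoszD lez_nat -!big_distrr -mulnDr /=.
  by rewrite -mulnA mulnC leq_pmul2l // muln_gt0 da0 db0.
exists O; split=> [k|l].
  rewrite Na_a leq_add2l leq_pmul2r // (leq_trans _ (Oa k)) //.
  by apply/subset_leq_card/subsetP=> l; rewrite !inE.
rewrite Nb_b leq_add2l leq_pmul2r // (leq_trans _ (Ob l)) //.
by apply/subset_leq_card/subsetP=> k; rewrite !inE andbT.
Qed.

From mathcomp Require Import all_classical all_reals all_analysis.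
From mathcomp Require Import measurable_realfun.

(** * Zero sets of polynomials in independent nonatomic variables *)

Section MeasureTheory.
Local Open Scope classical_set_scope.

(** Fubini for the pair [(w, Z w)]. The first component is [w] itself, seen through the coarser
    sigma-algebra generated by [G], so independence makes the law of the pair a product. *)
Lemma independent_graph_null d d2 (Omega : measurableType d) (T2 : measurableType d2)
    (R : realType) (P : probability Omega R) (G : set (set Omega)) (Z : Omega -> T2)
    (E : set (g_sigma_algebraType G * T2)) :
  G `<=` measurable -> G setT -> setI_closed G -> measurable_fun setT Z ->
  (forall C B, G C -> measurable B -> P (C `&` Z @^-1` B) = (P C * P (Z @^-1` B))%E) ->
  measurable E -> (forall w, P (Z @^-1` (xsection E w)) = 0%E) ->
  P [set w | E (w, Z w)] = 0%E.
Proof.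
move=> Gm GT GI mZ ind mE E0.
have sGm : <<s G >> `<=` measurable.
  by apply: smallest_sub => //; exact: sigma_algebra_measurable.
have mid : measurable_fun setT (id : Omega -> g_sigma_algebraType G).
  by move=> _ B mB; rewrite setTI preimage_id; apply: sGm.
have mpair : @measurable_fun _ _ Omega (g_sigma_algebraType G * T2)%type setT
    (fun w => (w, Z w)).
  exact: (measurable_fun_pair mid mZ).
pose X1 : {mfun Omega >-> g_sigma_algebraType G} := mfun_Sub (mem_set mid).
pose X2 : {mfun Omega >-> T2} := mfun_Sub (mem_set mZ).
pose X12 : {mfun Omega >-> (g_sigma_algebraType G * T2)%type} := mfun_Sub (mem_set mpair).
have prod_law A B : measurable A -> measurable B ->
    distribution P X12 (A `*` B) = (distribution P X1 A * distribution P X2 B)%E.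
  move=> mA mB; rewrite /distribution /pushforward /=.
  have mZB : measurable (Z @^-1` B) by rewrite -[X in measurable X]setTI; exact: (mZ measurableT B mB).
  have r0 : 0 <= fine (P (Z @^-1` B)) by rewrite fine_ge0.
  (* For fixed [B], both sides are finite measures in [A] that agree on the pi-system [G]. *)
  transitivity (mrestr P mZB A).
    by rewrite /mrestr; congr (P _); apply/seteqP; split.
  transitivity (mscale (NngNum r0) P A); last first.
    by rewrite /mscale /= muleC fineK // fin_num_measure.
  apply: (g_sigma_algebra_measure_unique G Gm (fun=> setT)) => //.
  - by rewrite bigcup_const.
  - move=> C GC /=; rewrite /mrestr /mscale /= ind // muleC fineK //.
    by rewrite fin_num_measure.
  - move=> _ /=; rewrite /mrestr setTI.
    by rewrite (le_lt_trans (probability_le1 P mZB)) // ltry.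
transitivity (distribution P X12 E) => //.
rewrite -(product_measure_unique prod_law mE) /product_measure1.
rewrite (eq_integral (cst 0%E)) ?integral0 // => w _ /=.
exact: E0.
Qed.

Section ComplexMeasurable.
Variables (R : realType) (d : measure_display) (T : measurableType d).

Definition cmeasurable (f : T -> R[i]) :=
  measurable_fun setT (fun x => complex.Re (f x)) /\
  measurable_fun setT (fun x => complex.Im (f x)).

Lemma cmeasurable_peval (J : Type) (D : pexpr R[i] J) (v : T -> J -> R[i]) :
  (forall x, cmeasurable (v^~ x)) -> cmeasurable (fun t => peval id (v t) D).
Proof.
move=> mv; elim: D => [a|x|D1 [r1 i1] D2 [r2 i2]|D1 [r1 i1] D2 [r2 i2]] /=.
- by split; exact: measurable_cst.
- exact: mv.
- split.
    apply: (eq_measurable_fun (fun t => complex.Re (peval id (v t) D1) +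
      complex.Re (peval id (v t) D2))); last exact: measurable_funD.
    by move=> t _ /=; case: (peval _ _ D1) => a b; case: (peval _ _ D2).
  apply: (eq_measurable_fun (fun t => complex.Im (peval id (v t) D1) +
      complex.Im (peval id (v t) D2))); last exact: measurable_funD.
  by move=> t _ /=; case: (peval _ _ D1) => a b; case: (peval _ _ D2).
split.
  apply: (eq_measurable_fun (fun t =>
      complex.Re (peval id (v t) D1) * complex.Re (peval id (v t) D2) -
      complex.Im (peval id (v t) D1) * complex.Im (peval id (v t) D2))).
    by move=> t _ /=; case: (peval _ _ D1) => a b; case: (peval _ _ D2).
  by apply: measurable_funB; exact: measurable_funM.
apply: (eq_measurable_fun (fun t =>
      complex.Re (peval id (v t) D1) * complex.Im (peval id (v t) D2) +
      complex.Im (peval id (v t) D1) * complex.Re (peval id (v t) D2))).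
  by move=> t _ /=; case: (peval _ _ D1) => a b; case: (peval _ _ D2).
by apply: measurable_funD; exact: measurable_funM.
Qed.

Lemma measurable_czero (f : T -> R[i]) : cmeasurable f -> measurable [set t | f t = 0].
Proof.
move=> [mr mi].
have -> : [set t | f t = 0] = (fun t => complex.Re (f t)) @^-1` [set 0] `&`
    (fun t => complex.Im (f t)) @^-1` [set 0].
  by apply/seteqP; split=> t /=; [move=> ->|case: (f t) => a b /= [-> ->]].
apply: measurableI; rewrite -[X in measurable X]setTI.
  exact: mr.
exact: mi.
Qed.

End ComplexMeasurable.

Section PolynomialAlmostEverywhere.
Context (R : realType) (d : measure_display) (Omega : measurableType d).
Context (P : probability Omega R) (J : finType) (X : J -> Omega -> R * R).
Hypothesis mX : forall x, measurable_fun setT (X x).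
Hypothesis indX : forall A : J -> set (R * R), (forall x, measurable (A x)) ->
  fine (P [set w | forall x, A x (X x w)]) = \prod_x fine (P (X x @^-1` A x)).
Hypothesis X_nonatomic : forall x z, P (X x @^-1` [set z]) = 0%E.

Let cpx (p : R * R) : R[i] := Complex p.1 p.2.

Let mpre x A : measurable A -> measurable (X x @^-1` A).
Proof. by move=> mA; rewrite -[X in measurable X]setTI; exact: mX. Qed.

Let box (A : J -> set (R * R)) := [set w | forall x, A x (X x w)].

Let mbox A : (forall x, measurable (A x)) -> measurable (box A).
Proof.
move=> mA; have -> : box A = \bigcap_(x in [set: J]) (X x @^-1` A x).
  by apply/seteqP; split=> w Aw x //=; exact: Aw.
by apply: fin_bigcap_measurable => // x _; apply: mpre.
Qed.

(** The cylinders over the coordinates in [r]: a pi-system whose sigma-algebra makes these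
    coordinates measurable. *)
Let boxes (r : seq J) : set (set Omega) :=
  [set C | exists A, [/\ forall y, measurable (A y), forall y, y \notin r -> A y = setT &
                         C = box A]].

Let indep_boxes r x C B : x \notin r -> boxes r C -> measurable B ->
  P (C `&` X x @^-1` B) = (P C * P (X x @^-1` B))%E.
Proof.
move=> xr [A [mA AT ->]] mB.
pose A' y := if y == x then B else A y.
have mA' y : measurable (A' y) by rewrite /A'; case: ifP.
have -> : box A `&` X x @^-1` B = box A'.
  apply/seteqP; split=> [w [Aw Bw] y|w Aw]; first by rewrite /A'; case: eqP => [->|].
  split=> [y|]; last by have := Aw x; rewrite /A' eqxx.
  by have := Aw y; rewrite /A'; case: eqP => [->|//]; rewrite AT.
rewrite -[LHS]fineK ?fin_num_measure //; last exact: mbox.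
rewrite -[P (box A)]fineK ?fin_num_measure //; last exact: mbox.
rewrite -[P (X x @^-1` B)]fineK ?fin_num_measure //; last exact: mpre.
rewrite -EFinM !indX // (bigD1 x) //= [in RHS](bigD1 x) //= {1}/A' eqxx.
rewrite AT // preimage_setT probability_setT mul1r mulrC; congr (_ * _)%:E.
by apply: eq_bigr => y yx; rewrite /A' (negPf yx).
Qed.

Let boxes_measurable r : boxes r `<=` measurable.
Proof. by move=> _ [A [mA _ ->]]; exact: mbox. Qed.

Let boxesT r : boxes r setT.
Proof. by exists (fun=> setT); split=> //; apply/seteqP; split. Qed.

Let boxesI r : setI_closed (boxes r).
Proof.
move=> _ _ [A [mA AT ->]] [B [mB BT ->]]; exists (fun y => A y `&` B y); split.
- by move=> y; exact: measurableI.
- by move=> y yr; rewrite AT // BT // setTI.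
by apply/seteqP; split=> w; [case=> Aw Bw y; split|move=> H; split=> y; case: (H y)].
Qed.

Let measurable_boxes r y :
  y \in r -> measurable_fun setT (X y : g_sigma_algebraType (boxes r) -> R * R).
Proof.
move=> yr _ B mB; rewrite setTI; apply: sub_sigma_algebra.
exists (fun z => if z == y then B else setT); split=> [z|z zr|].
- by case: ifP.
- by case: eqP zr yr => // -> /negPf ->.
apply/seteqP; split=> w /=; first by move=> Bw z; case: eqP => [->|].
by move=> /(_ y); rewrite eqxx.
Qed.

Let finite_null x (rs : seq R[i]) : P.-negligible [set w | cpx (X x w) \in rs].
Proof.
elim: rs => [|z rs IHrs].
  by apply: negligibleS (negligible_set0 P) => w /=; rewrite in_nil.
have Nz : P.-negligible (X x @^-1` [set (complex.Re z, complex.Im z)]).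
  apply/negligibleP; last exact: X_nonatomic.
  apply: mpre; have -> : [set (complex.Re z, complex.Im z)] =
      [set complex.Re z] `*` [set complex.Im z].
    by apply/seteqP; split=> [_ ->|[a b] [/= -> ->]].
  exact: measurableX.
apply: negligibleS (negligibleU Nz IHrs) => w /=; rewrite in_cons => /orP[/eqP<-|]; last by right.
by left => /=; case: (X x w).
Qed.

(* The coordinates of a point where [D] does not vanish are replaced one by one
   by the random ones: each time, the values of the new coordinate at which [D]
   vanishes are the roots of a nonzero polynomial. *)
Lemma peval_ae_neq0 (D : pexpr R[i] J) :
  (exists c, peval id c D != 0) ->
  P.-negligible [set w | peval id (fun x => cpx (X x w)) D = 0].
Proof.
move=> [c Dc].
pose v (r : seq J) w y := if y \in r then cpx (X y w) else c y.
suff H r : uniq r -> P.-negligible [set w | peval id (v r w) D = 0].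
  apply: negligibleS (H (enum J) (enum_uniq J)) => w /= <-; apply: eq_peval => // y.
  by rewrite /v mem_enum.
elim: r => [_|x r IHr /= /andP[xr /IHr Nr]].
  apply: negligibleS (negligible_set0 P) => w /= Dw; case/negP: Dc; apply/eqP.
  by rewrite -[RHS]Dw; exact: eq_peval.
pose T1 := g_sigma_algebraType (boxes r).
pose u (p : T1 * (R * R)) y := if y == x then cpx p.2 else v r p.1 y.
(* Only the newly created zeros: the points where [D] vanished before the replacement are negligible
   by induction. *)
pose E : set (T1 * (R * R)) :=
  [set p | peval id (u p) D = 0] `\` [set p | peval id (v r p.1) D = 0].
have mv y : cmeasurable (fun p : T1 * (R * R) => v r p.1 y).
  rewrite /v; have [yr|_] := boolP (y \in r); last by split; exact: measurable_cst.
  have mXy : measurable_fun setT (fun p : T1 * (R * R) => X y p.1).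
    exact: (measurableT_comp (measurable_boxes yr) measurable_fst).
  split.
    exact: (measurableT_comp measurable_fst mXy).
  exact: (measurableT_comp measurable_snd mXy).
have mu_ y : cmeasurable (u^~ y).
  rewrite /u; have [_|_] := boolP (y == x); last exact: mv.
  split.
    exact: (measurableT_comp measurable_fst measurable_snd).
  exact: (measurableT_comp measurable_snd measurable_snd).
have mE : measurable E.
  rewrite /E; apply: measurableD; apply: measurable_czero.
    exact: cmeasurable_peval mu_.
  exact: cmeasurable_peval mv.
have Esec w : P (X x @^-1` (xsection E w)) = 0%E.
  have mEw : measurable (X x @^-1` (xsection E w)).
    by apply: mpre; exact: measurable_xsection.
  apply/negligibleP => //.
  have [Dw|/eqP Dw] := pselect (peval id (v r w) D = 0).
    apply: negligibleS (negligible_set0 P) => w' /=.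
    by rewrite /xsection /= inE => -[_]; exact.
  (* [D] as a polynomial in the new coordinate. It is nonzero, since at [c x] it takes the value
     before the replacement. *)
  pose Q : {poly R[i]} := peval polyC (fun y => if y == x then 'X else (v r w y)%:P) D.
  have QE z : Q.[z] = peval id (fun y => if y == x then z else v r w y) D.
    rewrite -horner_evalE [LHS](peval_rmorph (horner_eval z)).
    apply: eq_peval => y /=; rewrite /horner_eval; first by rewrite hornerC.
    by case: ifP => _; rewrite ?hornerX ?hornerC.
  have Q0 : Q != 0.
    apply: contra Dw => /eqP Q0; have := QE (c x); rewrite Q0 horner0 => ->.
    apply/eqP/eq_peval => // y; case: eqP => // ->.
    by rewrite /v (negPf xr).
  have [rs Qrs] := closed_field_poly_normal Q.
  apply: negligibleS (finite_null x rs) => w' /=; rewrite /xsection /= inE => -[/= uD _].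
  rewrite -root_prod_XsubC; have : root Q (cpx (X x w')) by apply/eqP; rewrite QE -[RHS]uD.
  by rewrite Qrs rootZ // lead_coef_eq0.
have NE := independent_graph_null (@boxes_measurable r) (boxesT r) (@boxesI r) (mX x)
  (fun C B => @indep_boxes r x C B xr) mE Esec.
have mid : @measurable_fun _ _ Omega (T1 * (R * R))%type setT (fun w => (w, X x w)).
  apply: (@measurable_fun_pair _ _ _ Omega T1 _ id) => //.
  move=> _ B mB; rewrite setTI preimage_id.
  by apply: (smallest_sub (@sigma_algebra_measurable _ Omega) (@boxes_measurable r)).
have NE' : P.-negligible [set w | E (w, X x w)].
  apply/negligibleP; last exact: NE.
  by rewrite -[X in measurable X]setTI; exact: mid.
apply: negligibleS (negligibleU Nr NE') => w /= Dw.
have [|Dr] := pselect (peval id (v r w) D = 0); [by left|right; split=> //=].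
rewrite -[RHS]Dw; apply: eq_peval => // y; rewrite /u /v inE /=.
by case: eqP => [->|].
Qed.

End PolynomialAlmostEverywhere.

End MeasureTheory.

(** * Enumeration of the channel entries without repetition *)

Lemma uniq_flatten_map (A B C : eqType) (g : A -> seq B) (e : A -> C) (h : B -> C)
    (s : seq A) :
  injective e -> (forall a b, b \in g a -> h b = e a) -> (forall a, uniq (g a)) ->
  uniq s -> uniq (flatten (map g s)).
Proof.
move=> e_inj hg ug; elim: s => //= a s IHs /andP[as_ us].
rewrite cat_uniq ug IHs // andbT; apply/hasPn => b /flattenP[_ /mapP[a' a's ->] ba'].
apply: contra as_ => ba; suff -> : a = a' by [].
by apply: e_inj; rewrite -(hg _ _ ba) (hg _ _ ba').
Qed.

Definition mxcoords (I : eqType) (m n : I -> nat) (s : seq I) : seq (mxfam m n) :=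
  flatten [seq flatten [seq [seq mxcoord i j | j <- enum 'I_(n k)]
    | i <- enum 'I_(m k)] | k <- s].

Lemma mxcoords_uniq (I : eqType) (m n : I -> nat) (s : seq I) :
  uniq s -> uniq (mxcoords m n s).
Proof.
apply: (@uniq_flatten_map _ _ _ _ id tag) => // [k x|k].
  by move=> /flattenP[_ /mapP[i _ ->] /mapP[j _ ->]].
apply: (@uniq_flatten_map _ _ _ _ (@nat_of_ord _) (fun x => nat_of_ord (tagged x).1)) => //.
- exact: ord_inj.
- by move=> i x /mapP[j _ ->].
- move=> i; rewrite map_inj_uniq ?enum_uniq // => j j' /eqP.
  by rewrite /mxcoord -tag_eqE /tag_eq /= eqxx tagged_asE => /eqP[].
exact: enum_uniq.
Qed.

Lemma mem_mxcoords (I : eqType) (m n : I -> nat) (s : seq I) x :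
  tag x \in s -> x \in mxcoords m n s.
Proof.
case: x => k [i j] /= ks; apply/flatten_mapP; exists k => //.
apply/flatten_mapP; exists i; first by rewrite mem_enum.
by apply/mapP; exists j; rewrite ?mem_enum.
Qed.

Lemma map_mxcoords (I : eqType) (T : Type) (m n : I -> nat) (s : seq I)
    (f : mxfam m n -> T) :
  map f (mxcoords m n s) =
  flatten [seq flatten [seq [seq f (mxcoord i j) | j <- enum 'I_(n k)]
    | i <- enum 'I_(m k)] | k <- s].
Proof.
rewrite /mxcoords map_flatten -map_comp; congr flatten; apply: eq_map => k /=.
rewrite map_flatten -map_comp; congr flatten; apply: eq_map => i /=.
by rewrite -map_comp.
Qed.

Definition sum_enum (A B : eqType) (s : seq A) (t : seq B) : seq (A + B) :=
  map inl s ++ map inr t.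

Lemma map_sum_enum (A B : eqType) (T : Type) (s : seq A) (t : seq B) (f : A + B -> T) :
  map f (sum_enum s t) = map (f \o inl) s ++ map (f \o inr) t.
Proof. by rewrite map_cat -!map_comp. Qed.

Lemma sum_enum_uniq (A B : eqType) (s : seq A) (t : seq B) :
  uniq s -> uniq t -> uniq (sum_enum s t).
Proof.
move=> us ut; rewrite cat_uniq !map_inj_uniq ?us ?ut ?andbT => [|x y []|x y []] //.
by apply/hasPn => _ /mapP[b _ ->]; apply/mapP => -[].
Qed.

Lemma mem_sum_enum (A B : eqType) (s : seq A) (t : seq B) :
  (forall x, x \in s) -> (forall y, y \in t) -> forall z, z \in sum_enum s t.
Proof.
by move=> sx ty [x|y]; rewrite mem_cat map_f ?orbT.
Qed.

Section Entries.
Variables (K L Ma Mb : nat) (Na : 'I_K -> nat) (Nb : 'I_L -> nat).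

(** The order is that of [channel_entries], which thereby becomes a map over this list. *)
Definition chans : seq (chan Ma Mb Na Nb) :=
  sum_enum (mxcoords Na (fun=> Ma) (enum 'I_K))
  (sum_enum (mxcoords (fun kl : 'I_K * 'I_L => Na kl.1) (fun kl => Nb kl.2)
     [seq (k, l) | k <- enum 'I_K, l <- enum 'I_L])
  (sum_enum (mxcoords (fun=> Mb) Nb (enum 'I_L))
     (mxcoords (fun=> Mb) (fun=> Ma) [:: tt]))).

Lemma chans_uniq : uniq chans.
Proof.
apply: sum_enum_uniq; first exact: mxcoords_uniq (enum_uniq _).
apply: sum_enum_uniq; last apply: sum_enum_uniq.
- by apply/mxcoords_uniq/allpairs_uniq; rewrite ?enum_uniq // => -[? ?] [? ?].
- exact: mxcoords_uniq (enum_uniq _).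
exact: mxcoords_uniq.
Qed.

Lemma mem_chans x : x \in chans.
Proof.
apply: mem_sum_enum => [y|]; first by apply: mem_mxcoords; rewrite mem_enum.
apply: mem_sum_enum => [y|].
  by apply: mem_mxcoords; case: (tag y) => k l; apply/allpairs_f; rewrite mem_enum.
apply: mem_sum_enum => y; apply: mem_mxcoords; first by rewrite mem_enum.
by case: (tag y).
Qed.

Lemma channel_entriesE (R : realType) (T : Type)
    (Ha : forall k, T -> 'M[R[i]]_(Na k, Ma))
    (Ga : forall k l, T -> 'M[R[i]]_(Na k, Nb l))
    (Hb : forall l, T -> 'M[R[i]]_(Mb, Nb l)) (Gb : T -> 'M[R[i]]_(Mb, Ma)) :
  channel_entries Ha Ga Hb Gb =
  map (fun x w => mkchan (fun k => Ha k w) (fun k l => Ga k l w) (fun l => Hb l w) (Gb w) x)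
    chans.
Proof.
rewrite /channel_entries /chans !map_sum_enum !map_mxcoords.
congr (_ ++ (_ ++ (_ ++ _))); last by rewrite /= cats0.
elim: (enum 'I_K) => //= k ks ->; rewrite map_cat flatten_cat.
by congr (flatten _ ++ _); rewrite -map_comp.
Qed.

End Entries.

(** * Feasibility for the random channel *)

Lemma ctransK (R : rcfType) (m n : nat) (A : 'M[R[i]]_(m, n)) : ctrans (ctrans A) = A.
Proof. by apply/matrixP=> i j; rewrite !mxE conjCK. Qed.

Lemma feasible_aligned (R : rcfType) (K L Ma Mb : nat)
    (Na : 'I_K -> nat) (Nb : 'I_L -> nat)
    (Ha : forall k, 'M[R[i]]_(Na k, Ma)) (Ga : forall k l, 'M[R[i]]_(Na k, Nb l))
    (Hb : forall l, 'M[R[i]]_(Mb, Nb l)) (Gb : 'M[R[i]]_(Mb, Ma)) (da db : nat) W V A X :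
  @aligned_by R[i] K L Ma Mb Na Nb da db Ha Ga Hb Gb W V A X ->
  feasible Ha Ga Hb Gb (fun=> da) (fun=> db).
Proof.
case=> [[WGV XGA] [WHA XHV]].
exists A, (fun k => ctrans (W k)), V, (fun l => ctrans (X l)).
split; [split|split] => [k l|k l|k i ik|l j jl|k|l]; rewrite ctransK //.
- by rewrite WHA eq_sym (negPf ik) raddf0.
- by rewrite XHV eq_sym (negPf jl) raddf0.
- by rewrite WHA eqxx mxrank1.
by rewrite XHV eqxx mxrank1.
Qed.

Section IidFamily.
Local Open Scope classical_set_scope.
Context (R : realType) (d : measure_display) (T : measurableType d).
Context (P : probability T R) (J : finType) (f : J -> T -> R[i]) (s : seq J).
Hypotheses (us : uniq s) (fs : forall x, x \in s).
Hypothesis iid : iid_continuous P (map f s).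

Let X x w := reim (f x w).

Let idx_lt x : (index x s < size (map f s))%N.
Proof. by rewrite size_map index_mem. Qed.

Let idx x := Ordinal (idx_lt x).

Let idx_inj : injective idx.
Proof. by move=> x y /(congr1 val) /= /index_inj ->. Qed.

Let nth_idx x : nth (fun=> 0) (map f s) (idx x) = f x.
Proof. by rewrite (nth_map x) ?index_mem // nth_index. Qed.

Lemma iid_measurable x : measurable_fun setT (X x).
Proof. by have [m _ _ _] := iid; have := m (idx x); rewrite nth_idx. Qed.

Lemma iid_independent (A : J -> set (R * R)) : (forall x, measurable (A x)) ->
  fine (P [set w | forall x, A x (X x w)]) = \prod_x fine (P (X x @^-1` A x)).
Proof.
move=> mA; have [_ ind _ _] := iid.
(* The sets are carried over to positions in the list. As [s] lists [J] bijectively, every position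
   is some [idx x] and the default [setT] never occurs. *)
pose A' (j : 'I_(size (map f s))) :=
  if [pick x | idx x == j] is Some x then A x else setT.
have A'E x : A' (idx x) = A x.
  by rewrite /A'; case: pickP => [y /eqP/idx_inj->//|/(_ x)]; rewrite eqxx.
have idx_bij : bijective idx.
  apply: inj_card_bij; first exact: idx_inj.
  by rewrite card_ord size_map -(card_uniqP us) max_card.
have [idx' idxK idx'K] := idx_bij.
have mA' j : measurable (A' j) by rewrite -(idx'K j) A'E.
have := ind A' mA'; rewrite (reindex idx) /=; last exact: onW_bij.
under eq_bigr do rewrite nth_idx A'E.
move=> <-; congr (fine (P _)); apply/seteqP; split=> w Aw.
  by move=> j; rewrite -(idx'K j) A'E nth_idx; exact: Aw.
by move=> x; have := Aw (idx x); rewrite A'E nth_idx.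
Qed.

Lemma iid_nonatomic x z : P (X x @^-1` [set z]) = 0%E.
Proof.
have [_ _ _ ac] := iid; have := ac (idx x) [set z]; rewrite nth_idx; apply.
  rewrite (_ : [set z] = [set z.1] `*` [set z.2]); first exact: measurableX.
  by apply/seteqP; split=> [_ ->|[a b] [/= -> ->]]; last by case: z.
rewrite (_ : [set z] = [set z.1] `*` [set z.2]); last first.
  by apply/seteqP; split=> [_ ->|[a b] [/= -> ->]]; last by case: z.
rewrite product_measure1E // -[RHS](mule0 (@lebesgue_measure R [set z.1])).
by congr (_ * _)%E; exact: lebesgue_measure_set1.
Qed.

End IidFamily.

Theorem theorem3 (R : realType) (d : measure_display) (Omega : measurableType d)
  (P : probability Omega R)
  (K L Ma Mb : nat) (Na : 'I_K -> nat) (Nb : 'I_L -> nat)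
  (Ha : forall k, Omega -> 'M[R[i]]_(Na k, Ma))
  (Ga : forall k l, Omega -> 'M[R[i]]_(Na k, Nb l))
  (Hb : forall l, Omega -> 'M[R[i]]_(Mb, Nb l))
  (Gb : Omega -> 'M[R[i]]_(Mb, Ma))
  (da db : nat) :
  (0 < da)%N -> (0 < db)%N ->
  iid_continuous P (channel_entries Ha Ga Hb Gb) ->
  (K * da <= Ma)%N -> (L * db <= Mb)%N -> (K * da + L * db <= maxn Ma Mb)%N ->
  (forall k : 'I_K, (((Na k)%:Z - da%:Z) %% db%:Z)%Z = 0) ->
  (forall l : 'I_L, (((Nb l)%:Z - db%:Z) %% da%:Z)%Z = 0) ->
  (forall (Ia : {set 'I_K}) (Ib : {set 'I_L}),
     (#|Ia| * #|Ib| * da * db)%:Z <=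
       \sum_(k in Ia) da%:Z * ((Na k)%:Z - da%:Z)
       + \sum_(l in Ib) db%:Z * ((Nb l)%:Z - db%:Z)) ->
  {ae P, forall w, feasible (fun k => Ha k w) (fun k l => Ga k l w)
                            (fun l => Hb l w) (Gb w)
                            (fun _ : 'I_K => da) (fun _ : 'I_L => db)}.
Proof.
move=> da0 db0 iid leMa leMb leM modNa modNb cut.
have [own [leNa leNb]] := owner_ex da0 db0 modNa modNb cut.
have [D [nzD DP]] := @aligned_generic R[i] _ _ _ _ _ _ _ _ own leNa leNb leMa leMb leM.
rewrite channel_entriesE in iid.
pose c w : chan Ma Mb Na Nb -> R[i] :=
  mkchan (fun k => Ha k w) (fun k l => Ga k l w) (fun l => Hb l w) (Gb w).
have us := chans_uniq Ma Mb Na Nb; have fs := @mem_chans _ _ Ma Mb Na Nb.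
have := peval_ae_neq0 (iid_measurable fs iid) (iid_independent us fs iid)
  (iid_nonatomic fs iid) nzD.
(* The infeasible outcomes lie in the negligible zero set of [D]. *)
apply: negligibleS => w /= infeas; apply: contrapT => Dw; apply: infeas.
have Dcw : peval id (c w) D != 0.
  apply/eqP => Dcw; apply: Dw; rewrite -[RHS]Dcw; apply: eq_peval => // x.
  by rewrite /c; case: (mkchan _ _ _ _ _).
have [W [V [A [X]]]] := (aligned_byP da db (c w)).2 (DP _ Dcw).
have -> : chHa (c w) = (fun k => Ha k w).
  by apply: functional_extensionality_dep => k; exact: chHaE.
have -> : chGa (c w) = (fun k l => Ga k l w).
  by do 2!(apply: functional_extensionality_dep => ?); exact: chGaE.
have -> : chHb (c w) = (fun l => Hb l w).
  by apply: functional_extensionality_dep => l; exact: chHbE.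
have -> : chGb (c w) = Gb w by exact: chGbE.
exact: feasible_aligned.
Qed.
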